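(* Let $\mathcal{D}$ be an isotropic distribution on $\mathbb{R}^{d}$ with $\mathbb{P}_{\omega\sim\mathcal{D}}(\omega=0)=0$, let $\mathbf{z}\in\mathbb{R}^d$, let $f$ belong to class F1, and let $X=f(\omega^\top\mathbf{z})$ with $\omega\sim\mathcal{D}$. Then $\widehat{F}^{\mathrm{ort}}_{f,\mathcal{D}}(\mathbf{z})$ is an unbiased estimator of $F_{f,\mathcal{D}}(\mathbf{z})$, and for every $\epsilon>0$, $$\mathbb{P}\big[|\widehat{F}^{\mathrm{ort}}_{f,\mathcal{D}}(\mathbf{z})-F_{f,\mathcal{D}}(\mathbf{z})|\ge\epsilon\big]\le p(\epsilon),$$ where $p(\epsilon)=\exp(-s\mathcal{L}_X(F_{f,\mathcal{D}}(\mathbf{z})+\epsilon))+\exp(-s\mathcal{L}_X(F_{f,\mathcal{D}}(\mathbf{z})-\epsilon))$ in general, and, if $f$ takes values in $[a,b]$, one may take $p(\epsilon)=2\exp\big(-\frac{2s\epsilon^2}{(b-a)^2}\big)$. (These are the standard Cramér–Chernoff and Hoeffding upper bounds for $\mathbb{P}[|\widehat{F}^{\mathrm{iid}}_{f,\mathcal{D}}(\mathbf{z})-F_{f,\mathcal{D}}(\mathbf{z})|\ge\epsilon]$.) Moreover, if $\mathbb{E}[X^2]<\infty$, then $\mathrm{MSE}(\widehat{F}^{\mathrm{ort}}_{f,\mathcal{D}}(\mathbf{z}))\le\mathrm{MSE}(\widehat{F}^{\mathrm{iid}}_{f,\mathcal{D}}(\mathbf{z}))$.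
   Context: Isotropic: $Q\omega\overset{d}{=}\omega$ for $\omega\sim\mathcal{D}$ and every orthogonal $Q$. An orthogonal ensemble for $\mathcal{D}$ of size $m\le d$ is $l_iv_i$ ($i=1,\dots,m$), with $v_1,\dots,v_d$ the rows of a Haar-random orthogonal $d\times d$ matrix and $l_i$ i.i.d. copies of $\|\omega\|_2$ ($\omega\sim\mathcal{D}$) independent of the $v_i$. For general $s$, the (block-)orthogonal ensemble $\omega^{\mathrm{ort}}_1,\dots,\omega^{\mathrm{ort}}_s$ partitions $1,\dots,s$ into blocks of size at most $d$, each an orthogonal ensemble, different blocks independent; $\omega^{\mathrm{iid}}_1,\dots,\omega^{\mathrm{iid}}_s$ are i.i.d. from $\mathcal{D}$. $F_{f,\mathcal{D}}(\mathbf{z})=\mathbb{E}_{\omega\sim\mathcal{D}}[f(\omega^\top\mathbf{z})]$, $\widehat{F}^{\mathrm{iid}}_{f,\mathcal{D}}(\mathbf{z})=\frac1s\sum_i f((\omega^{\mathrm{iid}}_i)^\top\mathbf{z})$, $\widehat{F}^{\mathrm{ort}}_{f,\mathcal{D}}(\mathbf{z})=\frac1s\sum_i f((\omega^{\mathrm{ort}}_i)^\top\mathbf{z})$; MSE denotes mean squared error $\mathbb{E}[(\widehat F-F)^2]$. Class F1: $f(u)=g(|u|)$ with $g:[0,\infty)\to\mathbb{R}$ monotone. For a random variable $X$ with moment generating function $M_X(\theta)=\mathbb{E}[e^{\theta X}]$, the Legendre symbol is $\mathcal{L}_X(a)=\sup_{\theta>0}\log\frac{e^{\theta a}}{M_X(\theta)}$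 if $a>\mathbb{E}[X]$ and $\mathcal{L}_X(a)=\sup_{\theta<0}\log\frac{e^{\theta a}}{M_X(\theta)}$ if $a<\mathbb{E}[X]$. *)

(* Defs.v *)
From HB Require Import structures.
From mathcomp Require Import all_boot all_order all_algebra.
From mathcomp Require Import all_classical all_reals all_analysis.
Set Implicit Arguments. Unset Strict Implicit. Unset Printing Implicit Defensive.
Import Order.TTheory GRing.Theory Num.Theory.
Local Open Scope classical_set_scope.
Local Open Scope ring_scope.

Section Defs.
Context {R : realType}.

Definition dotv (dim : nat) (u v : 'rV[R]_dim) : R := \sum_i u 0 i * v 0 i.
Definition norm2 (dim : nat) (u : 'rV[R]_dim) : R := Num.sqrt (\sum_i u 0 i ^+ 2).

Definition orthogonal_mx (n : nat) (Q : 'M[R]_n) : Prop := Q *m Q^T = 1%:M.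

(* Borel sigma-algebra on matrices 'M_(m,n) = R^(m*n): generated by the
   coordinate maps. *)
Definition mx_meas (m n : nat) : set (set 'M[R]_(m, n)) :=
  <<s [set A : set 'M[R]_(m, n) | exists (i : 'I_m) (j : 'I_n) (B : set R),
               measurable B /\ A = [set M : 'M[R]_(m, n) | B (M i j)]] >>.

Definition classF1 (f : R -> R) : Prop :=
  exists g : R -> R,
    ((forall x y, 0 <= x -> x <= y -> g x <= g y) \/
     (forall x y, 0 <= x -> x <= y -> g y <= g x)) /\
    forall u, f u = g `|u|.

Context {d0 : measure_display} {T : measurableType d0} (P : probability T R).

Definition rand_mx (m n : nat) (X : T -> 'M[R]_(m, n)) : Prop :=
  forall i j, measurable_fun setT (fun t => X t i j).

Definition same_law_mx (m n : nat) (X Y : T -> 'M[R]_(m, n)) : Prop :=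
  forall A, mx_meas A -> P (X @^-1` A) = P (Y @^-1` A).
Definition same_law (X Y : T -> R) : Prop :=
  forall A : set R, measurable A -> P (X @^-1` A) = P (Y @^-1` A).

Definition events_mx (m n : nat) (X : T -> 'M[R]_(m, n)) : set (set T) :=
  [set E | exists2 A, mx_meas A & E = X @^-1` A].
Definition events (X : T -> R) : set (set T) :=
  [set E | exists2 A : set R, measurable A & E = X @^-1` A].

Definition mutually_indep (I : finType) (F : I -> set (set T)) : Prop :=
  forall E : I -> set T, (forall i, F i (E i)) ->
    fine (P (\bigcap_i E i)) = \prod_i fine (P (E i)).

(* Haar-distributed random orthogonal matrix: orthogonal-valued, and its law
   is invariant under left multiplication by every orthogonal matrix (this
   characterizes the Haar probability measure on the compact group O(n)). *)
Definition haar_orthogonal (n : nat) (M : T -> 'M[R]_n) : Prop :=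
  rand_mx M /\ (forall t, orthogonal_mx (M t)) /\
  forall Q : 'M[R]_n, orthogonal_mx Q -> same_law_mx (fun t => Q *m M t) M.

Local Open Scope ereal_scope.

Definition expect (X : T -> R) : \bar R := \int[P]_t (X t)%:E.

Definition mgf (X : T -> R) (theta : R) : \bar R :=
  \int[P]_t (expR (theta * X t))%:E.

Definition legendre_term (X : T -> R) (a theta : R) : \bar R :=
  match mgf X theta with
  | r%:E => (ln (expR (theta * a) / r))%:E
  | +oo => -oo
  | -oo => +oo
  end.

Definition legendre (X : T -> R) (a : R) : \bar R :=
  if (fine (expect X) < a)%R then
    ereal_sup [set legendre_term X a theta | theta in [set th : R | (0 < th)%R]]
  else
    ereal_sup [set legendre_term X a theta | theta in [set th : R | (th < 0)%R]].

End Defs.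

(* Main.v *)
(* Conditionally on the lengths, the coordinates of the sample are those of
   u = M z for Haar orthogonal matrices M, and the heart of the matter is that
   nonnegative functions of the |u_j| that are all monotone in the same direction
   are negatively dependent: E prod_j h_j(u_j) <= prod_j E h_j(u_j).

   Fix a coordinate p. Composing an independent copy of M with the reflection
   that sends M e_p back to e_p yields a random matrix N fixing e_p, whose law is
   invariant under the orthogonal matrices fixing e_p. As u and N^T u have the
   same law and the same p-th coordinate, prod_{j <> p} h_j(u_j) may be replaced
   by its average over N, which depends only on the norm of the part of u
   orthogonal to e_p, i.e. on |u_p|, and is monotone in |u_p| in the direction
   opposite to h_p. Chebyshev's association inequality then splits off the p-th
   factor.

   Independence of the blocks and of the lengths, together with isotropy, turns
   this into E prod_i h_i(omega_i^T z) <= prod_i E h_i(omega^T z). Taking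
   h_i = exp (theta f) bounds the moment generating function of the orthogonal
   estimator by that of the i.i.d. one; taking two factors |f - f(0)| gives
   nonpositive covariances, hence the bound on the mean squared error. *)

Require Import Defs.
From HB Require Import structures.
From mathcomp Require Import all_boot all_order all_algebra.
From mathcomp Require Import all_classical all_reals all_analysis.
From mathcomp Require Import measurable_realfun ring lra.
Set Implicit Arguments. Unset Strict Implicit. Unset Printing Implicit Defensive.
Import Order.TTheory GRing.Theory Num.Theory.
Local Open Scope classical_set_scope.
Local Open Scope ring_scope.

(** * Decoupling of independent random elements *)

Section independence.
Context {R : realType} {d : measure_display} {T : measurableType d}
  (P : probability T R).
Local Open Scope ereal_scope.

(** As functions of [A], both sides are finite measures: [P] restricted to [B], and [P] scaled by
    [P B]. They agree on a pi-system containing the whole space, hence on the sigma-algebra it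
    generates. *)
Let indepr_g_sigma (C : set (set T)) (B : set T) :
  C `<=` measurable -> setI_closed C -> C setT -> measurable B ->
  (forall A, C A -> P (A `&` B) = P A * P B) ->
  forall A, <<s C >> A -> P (A `&` B) = P A * P B.
Proof.
move=> mC IC CT mB CB A sA.
have PB0 : (0 <= fine (P B))%R by exact: fine_ge0.
rewrite muleC -(fineK (fin_num_measure P B mB)).
apply: (@g_sigma_algebra_measure_unique _ _ _ C mC (fun=> setT) _ _
  (mrestr P mB) (mscale (NngNum PB0) P)) => //.
- by apply/seteqP; split=> // x _; exists 0%N.
- by move=> D CD; rewrite [LHS]CB//= /mscale/= fineK ?fin_num_measure// [LHS]muleC.

- by move=> _; rewrite /= /mrestr/= setTI ltey_eq fin_num_measure.
Qed.

Lemma indep_g_sigma (C1 C2 : set (set T)) :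
  C1 `<=` measurable -> C2 `<=` measurable ->
  setI_closed C1 -> setI_closed C2 -> C1 setT -> C2 setT ->
  (forall A B, C1 A -> C2 B -> P (A `&` B) = P A * P B) ->
  forall A B, <<s C1 >> A -> <<s C2 >> B -> P (A `&` B) = P A * P B.
Proof.
move=> mC1 mC2 IC1 IC2 C1T C2T C12 A B sA sB.
have sm C : C `<=` measurable -> <<s C >> `<=` (measurable : set (set T)).
  by move=> mC; apply: smallest_sub => //; exact: sigma_algebra_measurable.
apply: (@indepr_g_sigma C1) => //; first exact: (sm C2).
move=> D CD; rewrite setIC muleC.
apply: (@indepr_g_sigma C2) => //; first exact: mC1.
by move=> E CE; rewrite setIC muleC C12.
Qed.

End independence.

Section decoupling.
Context {R : realType} {d d1 d2 : measure_display} {T : measurableType d}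
  (P : probability T R) {T1 : measurableType d1} {T2 : measurableType d2}.
Local Open Scope ereal_scope.

(** The law of the pair agrees with the product of the marginal laws on rectangles, hence
    everywhere; Tonelli's theorem then gives the iterated integral. *)
Lemma integral_decouple (X1 : T -> T1) (X2 : T -> T2) (phi : T1 * T2 -> \bar R) :
  measurable_fun setT X1 -> measurable_fun setT X2 ->
  (forall A B, measurable A -> measurable B ->
    P (X1 @^-1` A `&` X2 @^-1` B) = P (X1 @^-1` A) * P (X2 @^-1` B)) ->
  measurable_fun setT phi -> (forall x, 0 <= phi x) ->
  \int[P]_t phi (X1 t, X2 t) = \int[P]_x \int[P]_y phi (X1 x, X2 y).
Proof.
move=> m1 m2 X12 mphi phi0.
pose Y1 : {mfun T >-> T1} := HB.pack X1 (isMeasurableFun.Build _ _ _ _ _ m1).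
pose Y2 : {mfun T >-> T2} := HB.pack X2 (isMeasurableFun.Build _ _ _ _ _ m2).
have mD : measurable_fun [set: T] (fun t => (X1 t, X2 t)).
  exact: measurable_fun_pair.
pose D : {mfun T >-> (T1 * T2)%type} :=
  HB.pack (fun t => (X1 t, X2 t)) (isMeasurableFun.Build _ _ _ _ _ mD).
rewrite -(ge0_integral_distribution D mphi phi0).
transitivity (\int[distribution P Y1 \x distribution P Y2]_z phi z).
  apply: eq_measure_integral => A mA _; apply/esym.
  by apply: product_measure_unique => // B C mB mC; exact: X12.
rewrite (fubini_tonelli1 phi)// (ge0_integral_distribution Y1); last 2 first.
- exact: measurable_fun_fubini_tonelli_F.
- by move=> y; exact: integral_ge0.
apply: eq_integral => x _ /=.
by rewrite /fubini_F (ge0_integral_distribution Y2)//; exact: measurableT_comp.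
Qed.

End decoupling.

(** * Grouping of mutually independent families *)

Section mutual_independence.
Context {R : realType} {d : measure_display} {T : measurableType d}
  (P : probability T R) (I : finType) (F : I -> set (set T)).
Hypothesis Fm : forall i, F i `<=` measurable.
Hypothesis FI : forall i, setI_closed (F i).
Hypothesis FT : forall i, F i setT.
Hypothesis indF : mutually_indep P F.
Local Open Scope ereal_scope.

(* The pi-system generating the join of the F i for i in J. *)
Definition rects (J : {set I}) : set (set T) :=
  [set A | exists2 E : I -> set T,
    (forall i, F i (E i) /\ (i \notin J -> E i = setT)) & A = \bigcap_i E i].

Lemma rects_measurable (J : {set I}) : rects J `<=` measurable.
Proof.
move=> _ [E FE ->]; apply: fin_bigcap_measurable; first exact: finite_finset.
by move=> i _; have [/Fm] := FE i.
Qed.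

Lemma rects_setI (J : {set I}) : setI_closed (rects J).
Proof.
move=> _ _ [A FA ->] [B FB ->]; exists (fun i => A i `&` B i).
  move=> i; have [FAi Ai] := FA i; have [FBi Bi] := FB i; split; first exact: FI.
  by move=> iJ; rewrite Ai// Bi// setTI.
by rewrite bigcapI.
Qed.

Lemma rects_setT (J : {set I}) : rects J setT.
Proof. by exists (fun=> setT) => //; rewrite bigcapT. Qed.

Lemma sub_rects (J : {set I}) i : i \in J -> F i `<=` rects J.
Proof.
move=> iJ A FA; exists (fun j => if j == i then A else setT).
  by move=> j; case: eqVneq => [->|_]; split => //; rewrite iJ.
apply/seteqP; split=> [x Ax j _|x Ax]; first by case: ifP.
by have := Ax i Logic.I; rewrite eqxx.
Qed.

(** At each index at least one of the two sides is the whole space, so every factor of the product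
    over [I] splits. *)
Lemma rects_indep (J1 J2 : {set I}) A B : (forall i, i \in J1 -> i \notin J2) ->
  rects J1 A -> rects J2 B -> P (A `&` B) = P A * P B.
Proof.
move=> dJ rA rB.
have mA := rects_measurable rA; have mB := rects_measurable rB.
rewrite -[LHS]fineK ?fin_num_measure//; last exact: measurableI.
rewrite -[P A]fineK ?fin_num_measure// -[P B]fineK ?fin_num_measure//.
move: {mA mB} rA rB => [E FE ->] [G FG ->].
rewrite -bigcapI !indF; last 3 first.
- by move=> i; have [] := FG i.
- by move=> i; have [] := FE i.
- by move=> i; apply: FI; [have [] := FE i | have [] := FG i].
rewrite -EFinM -big_split/=; congr EFin; apply: eq_bigr => i _.
have [[_ Ei] [_ Gi]] := (FE i, FG i).
have [iJ1|/Ei->] := boolP (i \in J1).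
  by rewrite Gi ?dJ// setIT probability_setT mulr1.
by rewrite setTI probability_setT mul1r.
Qed.

Lemma measurable_fun_rects d' (U : measurableType d') (J : {set I}) i (X : T -> U) :
  i \in J -> (forall B, measurable B -> F i (X @^-1` B)) ->
  measurable_fun [set: g_sigma_algebraType (rects J)] X.
Proof.
move=> iJ FX _ B mB; rewrite setTI.
by apply: sub_sigma_algebra; exact: (sub_rects iJ (FX B mB)).
Qed.

(** The random elements are two identity maps, from [T] to [T] with the coarser sigma-algebras of
    [J1] and [J2]. Any function of the two groups of variables can thus be decoupled by duplicating
    the sample point, without forming joint random vectors. *)
Lemma integral_decouple_rects (J1 J2 : {set I})
    (phi : g_sigma_algebraType (rects J1) * g_sigma_algebraType (rects J2) -> \bar R) :
  (forall i, i \in J1 -> i \notin J2) -> measurable_fun setT phi -> (forall x, 0 <= phi x) ->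
  \int[P]_t phi (t, t) = \int[P]_x \int[P]_y phi (x, y).
Proof.
move=> dJ mphi phi0.
have sub J : <<s rects J >> `<=` (measurable : set (set T)).
  apply: smallest_sub; first exact: sigma_algebra_measurable.
  exact: rects_measurable.
have H := @integral_decouple R d _ _ T P _ _ (id : T -> g_sigma_algebraType (rects J1))
  (id : T -> g_sigma_algebraType (rects J2)) phi.
apply: H => //.
- by move=> ? A mA; rewrite setTI; exact: (sub _ _ mA).
- by move=> ? A mA; rewrite setTI; exact: (sub _ _ mA).
- move=> A B mA mB; apply: (@indep_g_sigma _ _ _ P (rects J1) (rects J2)) => //;
    try exact: rects_measurable; try exact: rects_setI; try exact: rects_setT.
  by move=> A' B'; exact: rects_indep.
Qed.

Lemma emeasurable_bigprod d' (U : measurableType d') (K : eqType) (r : seq K)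
    (Y : K -> U -> \bar R) :
  (forall k, k \in r -> measurable_fun setT (Y k)) ->
  measurable_fun setT (fun u => \prod_(k <- r) Y k u).
Proof.
elim: r => [|k r IH] mY.
  by under eq_fun do rewrite big_nil; exact: measurable_cst.
under eq_fun do rewrite big_cons.
apply: emeasurable_funM; first by apply: mY; rewrite mem_head.
by apply: IH => j jr; apply: mY; rewrite inE jr orbT.
Qed.

(** Induction on a duplicate-free list of indices: the head factor is decoupled from the product of
    the remaining ones. *)
Lemma integral_prod_indep (Y : I -> T -> \bar R) :
  (forall i t, 0 <= Y i t) ->
  (forall i B, measurable B -> F i (Y i @^-1` B)) ->
  \int[P]_t (\prod_i Y i t) = \prod_i \int[P]_t Y i t.
Proof.
move=> Y0 FY; rewrite -!big_enum/=.
under eq_integral do rewrite -big_enum/=.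
elim: (enum I) (enum_uniq I) => [_|i r IH /= /andP[ir ur]].
  under eq_integral do rewrite big_nil.
  by rewrite big_nil integral_cst// mul1e; exact: probability_setT.
have mY j : measurable_fun setT (Y j).
  by move=> _ B mB; rewrite setTI; exact: (Fm (FY j B mB)).
rewrite big_cons -IH//.
under [LHS]eq_integral do rewrite big_cons.
set G := fun t => \prod_(j <- r) Y j t.
have mG : measurable_fun setT G by exact: emeasurable_bigprod.
have G0 t : 0 <= G t by exact: prode_ge0.
rewrite (@integral_decouple_rects [set i] [set j in r] (fun x => Y i x.1 * G x.2)).
- rewrite /=; under eq_integral do rewrite (ge0_integralZl P measurableT mG)//.
  by rewrite (ge0_integralZr P measurableT (mY i))//; exact: integral_ge0.
- by move=> j; rewrite !inE => /eqP->.
- have m1 : measurable_fun [set: g_sigma_algebraType (rects [set i])] (Y i).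
    by apply: (measurable_fun_rects (i := i)); rewrite ?inE//; exact: FY.
  have m2 : measurable_fun [set: g_sigma_algebraType (rects [set j in r])] G.
    apply: emeasurable_bigprod => j jr.
    by apply: (measurable_fun_rects (i := j)); rewrite ?inE//; exact: FY.
  apply: emeasurable_funM; first exact: (measurableT_comp m1 measurable_fst).
  exact: (measurableT_comp m2 measurable_snd).
- by move=> x; rewrite mule_ge0.
Qed.

End mutual_independence.

(** * Reflections *)

Section householder.
Context {R : realType} {n : nat}.
Local Notation ev i := (@delta_mx R 1 n 0 i).
Implicit Types (a b v x : 'rV[R]_n) (Q : 'M[R]_n).

Lemma dotvE a b : dotv a b = (a *m b^T) 0 0.
Proof. by rewrite mxE; apply: eq_bigr => i _; rewrite mxE. Qed.

Lemma dotvC a b : dotv a b = dotv b a.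
Proof. by apply: eq_bigr => i _; rewrite mulrC. Qed.

Lemma dotvBl a b x : dotv (a - b) x = dotv a x - dotv b x.
Proof. by rewrite !dotvE mulmxBl !mxE. Qed.

Lemma dotvBr x a b : dotv x (a - b) = dotv x a - dotv x b.
Proof. by rewrite dotvC dotvBl dotvC (dotvC b). Qed.

Lemma dotvZl (c : R) a x : dotv (c *: a) x = c * dotv a x.
Proof. by rewrite !dotvE -scalemxAl mxE. Qed.

Lemma dotvZr (c : R) a x : dotv x (c *: a) = c * dotv x a.
Proof. by rewrite dotvC dotvZl dotvC. Qed.

Lemma dotv_ge0 a : 0 <= dotv a a.
Proof. by apply: sumr_ge0 => i _; rewrite -expr2 sqr_ge0. Qed.

Lemma dotv_eq0 a : dotv a a = 0 -> a = 0.
Proof.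
move=> /eqP; rewrite psumr_eq0; last by move=> i _; rewrite -expr2 sqr_ge0.
move=> /allP a0; apply/rowP => i; rewrite mxE; apply/eqP.
by have := a0 i (mem_index_enum i); rewrite /= mulf_eq0 orbb.
Qed.

Lemma mul_row_tr a b : a *m b^T = (dotv a b)%:M.
Proof. by apply/matrixP => i j; rewrite !ord1 dotvE [RHS]mxE eqxx mulr1n. Qed.

Lemma orthogonal_trmx Q : orthogonal_mx Q -> orthogonal_mx Q^T.
Proof. by rewrite /orthogonal_mx trmxK => /mulmx1C. Qed.

Lemma orthogonal_mulmx Q1 Q2 :
  orthogonal_mx Q1 -> orthogonal_mx Q2 -> orthogonal_mx (Q1 *m Q2).
Proof.
by move=> o1 o2; rewrite /orthogonal_mx trmx_mul mulmxA -(mulmxA Q1) o2 mulmx1.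
Qed.

Lemma dotv_orthogonal Q a b :
  orthogonal_mx Q -> dotv (a *m Q) (b *m Q) = dotv a b.
Proof. by move=> oQ; rewrite !dotvE trmx_mul mulmxA -(mulmxA a) oQ mulmx1. Qed.

(* For v = 0 the quotient is 2 / 0 = 0, so the reflection is the identity. *)
Definition householder v : 'M[R]_n := 1%:M - (2 / dotv v v) *: (v^T *m v).

Lemma householder_tr v : (householder v)^T = householder v.
Proof. by rewrite /householder linearB/= linearZ/= trmx1 trmx_mul trmxK. Qed.

Lemma mul_householder x v :
  x *m householder v = x - (2 / dotv v v * dotv x v) *: v.
Proof.
rewrite mulmxBr mulmx1 -scalemxAr mulmxA mul_row_tr mul_scalar_mx.
by rewrite scalerA.
Qed.

Lemma householder_orthogonal v : orthogonal_mx (householder v).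
Proof.
rewrite /orthogonal_mx householder_tr {1}/householder mulmxBl mul1mx.
rewrite -scalemxAl -mulmxA mul_householder.
set w := v - _; suff -> : w = - v.
  by rewrite mulmxN scalerN opprK /householder subrK.
rewrite /w; have [/dotv_eq0->|v0] := eqVneq (dotv v v) 0.
  by rewrite scaler0 subrr oppr0.
by rewrite divfK// scaler_nat mulr2n opprD addrA subrr sub0r.
Qed.

(** With [v = a - b], equal norms give [dotv v v = 2 * dotv a v], so the reflection subtracts
    exactly [v] from [a]. *)
Lemma mul_householderB a b : dotv a a = dotv b b -> a *m householder (a - b) = b.
Proof.
move=> ab; rewrite mul_householder; set v := a - b.
have [/dotv_eq0 v0|v0] := eqVneq (dotv v v) 0.
  by rewrite v0 scaler0 subr0; apply/eqP; rewrite -subr_eq0 -/v v0.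
have vE : dotv v v = 2 * dotv a v.
  rewrite /v !(dotvBl, dotvBr) -ab (dotvC b a); lra.
by rewrite mulrAC -vE divff// scale1r subKr.
Qed.

Lemma mul_householder_ortho x v : dotv x v = 0 -> x *m householder v = x.
Proof. by move=> xv; rewrite mul_householder xv mulr0 scale0r subr0. Qed.

Lemma householder_conj v Q : orthogonal_mx Q ->
  householder (v *m Q) = Q^T *m householder v *m Q.
Proof.
move=> oQ; have /mulmx1C QQ := oQ.
rewrite /householder dotv_orthogonal// mulmxBr mulmxBl mulmx1 QQ.
by rewrite -scalemxAr -scalemxAl trmx_mul !mulmxA.
Qed.

Lemma mul_delta_dotv x i : x 0 i = dotv x (ev i).
Proof.
rewrite /dotv (bigD1 i)//= big1 ?addr0 ?mxE ?eqxx ?mulr1// => j ji.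
by rewrite mxE (negbTE ji) andbF mulr0.
Qed.

Lemma dotv_delta i : dotv (ev i) (ev i) = 1.
Proof. by rewrite -mul_delta_dotv mxE !eqxx. Qed.

Lemma norm2_sqr x : norm2 x ^+ 2 = dotv x x.
Proof.
rewrite sqr_sqrtr; first by apply: eq_bigr => i _; rewrite expr2.
by apply: sumr_ge0 => i _; rewrite sqr_ge0.
Qed.

Lemma row_of_norm x i : exists2 Q : 'M[R]_n,
  orthogonal_mx Q & x = norm2 x *: (ev i *m Q).
Proof.
exists (householder (norm2 x *: ev i - x)).
  exact: householder_orthogonal.
rewrite scalemxAl mul_householderB//.
by rewrite dotvZl dotvZr dotv_delta mulr1 -expr2 norm2_sqr.
Qed.

(* Carries an orthogonal matrix into the stabilizer of the basis vector e_p, by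
   reflecting (Q e_p) back to e_p. *)
Definition fix_row (p : 'I_n) Q : 'M[R]_n :=
  householder (ev p *m Q^T - ev p) *m Q.

Lemma fix_row_orthogonal p Q : orthogonal_mx Q -> orthogonal_mx (fix_row p Q).
Proof. by move=> oQ; apply: orthogonal_mulmx => //; exact: householder_orthogonal. Qed.

Lemma fix_rowE p Q : orthogonal_mx Q -> ev p *m fix_row p Q = ev p.
Proof.
move=> oQ; have oQT := orthogonal_trmx oQ.
have eQ : dotv (ev p *m Q^T) (ev p *m Q^T) =
          dotv (ev p) (ev p).
  exact: dotv_orthogonal.
(* [H] sends [ev p *m Q^T] to [ev p]; being an involution, it also sends [ev p] to [ev p *m Q^T],
   which [Q] brings back to [ev p]. *)
have := mul_householderB eQ; set H := householder _ => aH.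
have HH : H *m H = 1%:M by rewrite -{2}[H]householder_tr; exact: householder_orthogonal.
rewrite /fix_row mulmxA -/H -[in X in X *m Q]aH -(mulmxA _ H H) HH mulmx1 -mulmxA.
by have /mulmx1C-> := oQ; rewrite mulmx1.
Qed.

Lemma fix_row_coord p Q x : orthogonal_mx Q -> (x *m fix_row p Q) 0 p = x 0 p.
Proof.
move=> oQ; rewrite !mul_delta_dotv -[in LHS](fix_rowE p oQ).
by rewrite dotv_orthogonal//; exact: fix_row_orthogonal.
Qed.

(** Equivariance under the stabilizer of e_p: through it, left invariance of the Haar law passes to
    the law of [fix_row p M] for such [k]. It follows from the conjugation rule for reflections. *)
Lemma fix_row_mul p Q k : orthogonal_mx k -> ev p *m k = ev p ->
  fix_row p (k *m Q) = k *m fix_row p Q.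
Proof.
move=> ok kp; have okT := orthogonal_trmx ok.
have kTp : ev p *m k^T = ev p.
  by rewrite -[in LHS]kp -mulmxA ok mulmx1.
have eE : ev p *m (k *m Q)^T - ev p = (ev p *m Q^T - ev p) *m k^T.
  by rewrite trmx_mul mulmxBl kTp mulmxA.
rewrite /fix_row eE householder_conj// trmxK -!mulmxA (mulmxA k^T).
by have /mulmx1C-> := ok; rewrite mul1mx.
Qed.

End householder.

(** * Random matrices and their laws *)

(* Real matrices, measured by their coordinate maps: the measurable sets are
   those of mx_meas. *)
Definition mx_carrier (R : realType) (m n : nat) : Type := 'M[R]_(m, n).
HB.instance Definition _ (R : realType) (m n : nat) :=
  Choice.copy (mx_carrier R m n) 'M[R]_(m, n).
HB.instance Definition _ (R : realType) (m n : nat) :=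
  isPointed.Build (mx_carrier R m n) (0 : 'M[R]_(m, n)).

Section random_matrices.
Context {R : realType}.

Definition coord_sets (m n : nat) : set (set (mx_carrier R m n)) :=
  [set A : set 'M[R]_(m, n) | exists (i : 'I_m) (j : 'I_n) (B : set R),
    measurable B /\ A = [set M : 'M[R]_(m, n) | B (M i j)]].

Definition mxT (m n : nat) : measurableType (sigma_display (@coord_sets m n)) :=
  g_sigma_algebraType (@coord_sets m n).

Lemma measurable_coord m n (i : 'I_m) (j : 'I_n) :
  measurable_fun [set: mxT m n] (fun M : 'M[R]_(m, n) => M i j).
Proof.
move=> _ B mB; rewrite setTI; apply: sub_sigma_algebra.
by exists i, j, B.
Qed.

Context {d : measure_display} {T : measurableType d}.

Lemma rand_mxP m n (X : T -> 'M[R]_(m, n)) :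
  rand_mx X <-> measurable_fun setT (X : T -> mxT m n).
Proof.
split=> [mX|mX i j]; last exact: (measurableT_comp (measurable_coord i j)).
apply: measurability; first by [].
move=> _ [_ [i [j [B [mB ->]]]] <-].
by have := mX i j measurableT B mB.
Qed.

Lemma rand_mx_cst m n (A : 'M[R]_(m, n)) : rand_mx (fun _ : T => A).
Proof. by move=> i j; exact: measurable_cst. Qed.

Lemma rand_mx_tr m n (X : T -> 'M[R]_(m, n)) :
  rand_mx X -> rand_mx (fun t => (X t)^T).
Proof. by move=> mX i j; under eq_fun do rewrite mxE; exact: mX. Qed.

Lemma rand_mxB m n (X Y : T -> 'M[R]_(m, n)) :
  rand_mx X -> rand_mx Y -> rand_mx (fun t => X t - Y t).
Proof.
move=> mX mY i j; under eq_fun do rewrite !mxE.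
by apply: measurable_funB; [exact: mX|exact: mY].
Qed.

Lemma rand_mxZ m n (c : T -> R) (X : T -> 'M[R]_(m, n)) :
  measurable_fun setT c -> rand_mx X -> rand_mx (fun t => c t *: X t).
Proof.
move=> mc mX i j; under eq_fun do rewrite mxE.
by apply: measurable_funM => //; exact: mX.
Qed.

Lemma rand_mxM m n p (X : T -> 'M[R]_(m, n)) (Y : T -> 'M[R]_(n, p)) :
  rand_mx X -> rand_mx Y -> rand_mx (fun t => X t *m Y t).
Proof.
move=> mX mY i j; under eq_fun do rewrite mxE.
apply: measurable_sum => k.
by apply: measurable_funM; [exact: mX|exact: mY].
Qed.

Lemma measurable_dotv n (X Y : T -> 'rV[R]_n) :
  rand_mx X -> rand_mx Y -> measurable_fun setT (fun t => dotv (X t) (Y t)).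
Proof.
by move=> mX mY; under eq_fun do rewrite dotvE; exact: rand_mxM (rand_mx_tr mY) _ _.
Qed.

Lemma rand_mx_householder n (X : T -> 'rV[R]_n) :
  rand_mx X -> rand_mx (fun t => householder (X t)).
Proof.
move=> mX; apply: rand_mxB; first exact: rand_mx_cst.
apply: rand_mxZ; last by apply: rand_mxM => //; exact: rand_mx_tr.
apply: measurable_funM; first exact: measurable_cst.
(* The inverse is written as a real power, which is measurable on the whole line, the value at 0
   included. *)
under eq_fun do rewrite -(powR_inv1 (dotv_ge0 _)).
by apply: (measurableT_comp (measurable_powR _)); exact: measurable_dotv.
Qed.

Lemma rand_mx_fix_row n (p : 'I_n) (X : T -> 'M[R]_n) :
  rand_mx X -> rand_mx (fun t => fix_row p (X t)).
Proof.
move=> mX; apply: rand_mxM => //; apply: rand_mx_householder.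
apply: rand_mxB; last exact: rand_mx_cst.
by apply: rand_mxM; [exact: rand_mx_cst|exact: rand_mx_tr].
Qed.

End random_matrices.

Section comp_random_matrices.
Context {R : realType} {d d' : measure_display}
  {T : measurableType d} {U : measurableType d'}.

Lemma rand_mx_comp m n (X : T -> 'M[R]_(m, n)) (g : U -> T) :
  rand_mx X -> measurable_fun setT g -> rand_mx (X \o g).
Proof. by move=> mX mg i j; exact: measurableT_comp (mX i j) mg. Qed.

End comp_random_matrices.

Section laws.
Context {R : realType} {d : measure_display} {T : measurableType d}
  (P : probability T R).
Local Open Scope ereal_scope.

Lemma integral_same_law d' (U : measurableType d') (X Y : T -> U) (phi : U -> \bar R) :
  measurable_fun setT X -> measurable_fun setT Y ->
  (forall A, measurable A -> P (X @^-1` A) = P (Y @^-1` A)) ->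
  measurable_fun setT phi -> (forall x, 0 <= phi x) ->
  \int[P]_t phi (X t) = \int[P]_t phi (Y t).
Proof.
move=> mX mY XY mphi phi0.
pose X' : {mfun T >-> U} := HB.pack X (isMeasurableFun.Build _ _ _ _ _ mX).
pose Y' : {mfun T >-> U} := HB.pack Y (isMeasurableFun.Build _ _ _ _ _ mY).
rewrite -(ge0_integral_distribution X' mphi phi0).
rewrite -(ge0_integral_distribution Y' mphi phi0).
by apply: eq_measure_integral => A mA _; exact: XY.
Qed.

Lemma integral_same_law_mx m n (X Y : T -> 'M[R]_(m, n)) (phi : mxT m n -> \bar R) :
  rand_mx X -> rand_mx Y -> same_law_mx P X Y ->
  measurable_fun setT phi -> (forall x, 0 <= phi x) ->
  \int[P]_t phi (X t) = \int[P]_t phi (Y t).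
Proof.
by move=> /rand_mxP mX /rand_mxP mY XY; exact: integral_same_law mX mY XY.
Qed.

Lemma integral_haar n (M : T -> 'M[R]_n) (Q : 'M[R]_n) (phi : mxT n n -> \bar R) :
  haar_orthogonal P M -> orthogonal_mx Q ->
  measurable_fun setT phi -> (forall x, 0 <= phi x) ->
  \int[P]_t phi (Q *m M t) = \int[P]_t phi (M t).
Proof.
move=> [mM [_ hM]] oQ; apply: integral_same_law_mx => //; last exact: hM.
by apply: rand_mxM => //; exact: rand_mx_cst.
Qed.

(* Chebyshev's association inequality. *)
Lemma integral_opposite (a : T -> R) (b : T -> \bar R) :
  measurable_fun setT a -> measurable_fun setT b ->
  (forall t, 0 <= a t)%R -> (forall t, 0 <= b t) ->
  (forall s t, (a s <= a t)%R /\ b t <= b s \/ (a t <= a s)%R /\ b s <= b t) ->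
  \int[P]_t ((a t)%:E * b t) <= (\int[P]_t (a t)%:E) * (\int[P]_t b t).
Proof.
move=> ma mb a0 b0 ab.
have mE : measurable_fun setT (EFin \o a) by exact/measurable_EFinP.
have mab : measurable_fun setT (fun t => (a t)%:E * b t) by exact: emeasurable_funM.
have ab0 s t : 0 <= (a s)%:E * b t by rewrite mule_ge0// lee_fin.
(* Rearrangement inequality for two pairs. Only the real number [x'] is split, as [(x' - x) + x], so
   no possibly infinite value is subtracted. *)
have swap (x x' : R) (y y' : \bar R) : (0 <= x)%R -> 0 <= y' -> (x <= x')%R -> y' <= y ->
    x%:E * y + x'%:E * y' <= x%:E * y' + x'%:E * y.
  move=> x0 y'0 xx' y'y; have y0 := le_trans y'0 y'y.
  rewrite -(subrK x x') EFinD !ge0_muleDl ?lee_fin ?subr_ge0//.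
  rewrite addeCA [leRHS]addeCA [X in _ + X <= _]addeC leeD2r//.
  by rewrite lee_wpmul2l// lee_fin subr_ge0.
(* Integrating this over two independent sample points, first [t] and then [s], yields
   [C + C <= A * B + A * B]. *)
have pw s t : (a s)%:E * b s + (a t)%:E * b t <= (a s)%:E * b t + (a t)%:E * b s.
  case: (ab s t) => -[h1 h2]; first exact: swap.
  by rewrite addeC [leRHS]addeC; exact: swap.
have cst_int (c : \bar R) : \int[P]_t (fun=> c) t = c.
  by rewrite integral_cst// [X in c * X]probability_setT mule1.
set A := \int[P]_t (a t)%:E; set B := \int[P]_t b t.
set C := \int[P]_t ((a t)%:E * b t).
have A0 : 0 <= A by apply: integral_ge0 => t _; rewrite lee_fin.
have B0 : 0 <= B by exact: integral_ge0.
have C0 : 0 <= C by exact: integral_ge0.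
have inl s : \int[P]_t ((a s)%:E * b s + (a t)%:E * b t) = (a s)%:E * b s + C.
  by rewrite ge0_integralD// cst_int.
have mul s : measurable_fun setT (fun t => (a s)%:E * b t).
  by apply: emeasurable_funM => //; exact: measurable_cst.
have mur s : measurable_fun setT (fun t => (a t)%:E * b s).
  by apply: emeasurable_funM => //; exact: measurable_cst.
have inr s : \int[P]_t ((a s)%:E * b t + (a t)%:E * b s) = (a s)%:E * B + A * b s.
  rewrite ge0_integralD//; congr (_ + _); first by rewrite ge0_integralZl// lee_fin.
  by rewrite ge0_integralZr// => t _; rewrite lee_fin.
have dbl : \int[P]_s ((a s)%:E * b s + C) <= \int[P]_s ((a s)%:E * B + A * b s).
  apply: ge0_le_integral => //.
  - by move=> s _; rewrite adde_ge0.
  - by apply: emeasurable_funD => //; exact: measurable_cst.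
  - by apply: emeasurable_funD; apply: emeasurable_funM => //; exact: measurable_cst.
  - move=> s _; rewrite -inl -inr; apply: ge0_le_integral => //.
    + by move=> t _; rewrite adde_ge0.
    + by apply: emeasurable_funD => //; exact: measurable_cst.
    + exact: emeasurable_funD.
have eL : \int[P]_s ((a s)%:E * b s + C) = C + C.
  by rewrite ge0_integralD// cst_int.
have eR : \int[P]_s ((a s)%:E * B + A * b s) = A * B + A * B.
  rewrite ge0_integralD//.
  - congr (_ + _); last by rewrite ge0_integralZl.
    by rewrite ge0_integralZr// => t _; rewrite lee_fin.
  - by move=> t _; rewrite mule_ge0// lee_fin.
  - by apply: emeasurable_funM => //; exact: measurable_cst.
  - by move=> t _; rewrite mule_ge0.
  - by apply: emeasurable_funM => //; exact: measurable_cst.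
(* Halving in the extended reals: if [A * B < C], adding the strict inequality to itself contradicts
   [dbl]. *)
move: dbl; rewrite eL eR; apply: contraTT; rewrite -!ltNge => h.
exact: lteD.
Qed.

End laws.

(** * Negative dependence of the coordinates of a rotated vector *)

Section haar_block.
Context {R : realType} {d : measure_display} {T : measurableType d}
  (P : probability T R) {n : nat} (M : T -> 'M[R]_n).
Hypothesis haarM : haar_orthogonal P M.
Variables (dir : bool) (h : 'I_n -> R -> R).
Hypothesis h_ge0 : forall j x, 0 <= h j x.
Hypothesis h_meas : forall j, measurable_fun setT (h j).
Hypothesis h_mono : forall j x y, `|x| <= `|y| ->
  if dir then h j x <= h j y else h j y <= h j x.
Local Notation ev i := (@delta_mx R 1 n 0 i).

Let mM : rand_mx M := haarM.1.
Let oM t : orthogonal_mx (M t) := haarM.2.1 t.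

Let H (r : seq 'I_n) (x : 'rV[R]_n) : R := \prod_(j <- r) h j (x 0 j).

Let H_ge0 r x : 0 <= H r x.
Proof. by apply: prodr_ge0 => j _; exact: h_ge0. Qed.

Let measurable_H d' (U : measurableType d') r (X : U -> 'rV[R]_n) :
  rand_mx X -> measurable_fun setT (fun t => (H r (X t))%:E).
Proof.
move=> mX; apply/measurable_EFinP; apply: measurable_prod => j _.
exact: measurableT_comp (mX 0 j).
Qed.

Let H_scale r x (c : R) : 0 <= c <= 1 ->
  if dir then H r (c *: x) <= H r x else H r x <= H r (c *: x).
Proof.
move=> /andP[c0 c1].
have cx j : `|(c *: x) 0 j| <= `|x 0 j|.
  by rewrite mxE normrM (ger0_norm c0) ler_piMl.
have hx j := h_mono j (cx j).
by case: dir hx => hx; apply: ler_prod => j _; rewrite h_ge0 hx.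
Qed.

Variable p : 'I_n.

(** The average of [H r] over the random orthogonal maps fixing e_p. *)
Let Phi r (x : 'rV[R]_n) : \bar R := (\int[P]_t (H r (x *m fix_row p (M t)))%:E)%E.

Let perp (x : 'rV[R]_n) : 'rV[R]_n := x - x 0 p *: ev p.

Let perp_ev x : dotv (perp x) (ev p) = 0.
Proof. by rewrite -mul_delta_dotv !mxE !eqxx mulr1 subrr. Qed.

Let dotv_perp x : dotv (perp x) (perp x) = dotv x x - x 0 p ^+ 2.
Proof.
rewrite {2}/perp dotvBr dotvZr perp_ev mulr0 subr0 dotvBl dotvZl.
by rewrite (dotvC (ev p)) -mul_delta_dotv expr2.
Qed.

(** Maps fixing e_p leave the component of [x] along e_p in place, where it affects only the p-th
    coordinate, which [H r] does not read. *)
Let Phi_perp r x : p \notin r -> Phi r x = Phi r (perp x).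
Proof.
move=> pr; apply: eq_integral => t _; congr EFin.
rewrite /H !big_seq; apply: eq_bigr => j jr; congr (h j _).
have jp : j != p by apply: contraNneq pr => <-.
rewrite /perp mulmxBl -scalemxAl fix_rowE// !mxE (negbTE jp) andbF mulr0.
by rewrite subr0.
Qed.

(** The reflection carrying [x] to [y] fixes e_p, both vectors being orthogonal to it, and is
    absorbed by the invariance of the Haar law. *)
Let Phi_eq_norm r x y : dotv x x = dotv y y ->
  dotv x (ev p) = 0 -> dotv y (ev p) = 0 -> Phi r x = Phi r y.
Proof.
move=> xy xp yp; set k := householder (x - y).
have ok : orthogonal_mx k by exact: householder_orthogonal.
have kp : ev p *m k = ev p.
  by apply: mul_householder_ortho; rewrite dotvC dotvBl xp yp subrr.
rewrite /Phi -(mul_householderB xy) -/k.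
rewrite -(integral_haar (Q := k) (phi := fun A : mxT n n =>
  (H r (x *m fix_row p A))%:E) haarM ok).
- by apply: eq_integral => t _; rewrite fix_row_mul// mulmxA.
- apply: measurable_H; apply: rand_mxM; first exact: rand_mx_cst.
  by apply: rand_mx_fix_row => i j; exact: measurable_coord.
- by move=> A; rewrite lee_fin.
Qed.

(* Moving mass of x into its p-th coordinate shrinks the others. *)
Let Phi_mono r x y : p \notin r -> dotv x x = dotv y y -> `|x 0 p| <= `|y 0 p| ->
  if dir then (Phi r y <= Phi r x)%E else (Phi r x <= Phi r y)%E.
Proof.
move=> pr xy xpyp; rewrite (Phi_perp x pr) (Phi_perp y pr).
set x' := perp x; set y' := perp y.
have y'x' : dotv y' y' <= dotv x' x'.
  rewrite !dotv_perp xy lerB//.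
  by rewrite -(real_normK (num_real (x 0 p))) -(real_normK (num_real (y 0 p))) lerXn2r ?nnegrE.
have x'0 := dotv_ge0 x'; have y'0 := dotv_ge0 y'.
(* The ratio of the norms of [y'] and [x'], so that [c *: x'] has the norm of [y']. If [x']
   vanishes, then so does [y'], and the default quotient 0 is the right value. *)
pose c := Num.sqrt (dotv y' y' / dotv x' x').
have c01 : 0 <= c <= 1.
  rewrite sqrtr_ge0/= -sqrtr1 ler_sqrt//.
  have [->|nz] := eqVneq (dotv x' x') 0; first by rewrite invr0 mulr0.
  by rewrite ler_pdivrMr ?mul1r// lt_neqAle eq_sym nz.
have cx' : dotv (c *: x') (c *: x') = dotv y' y'.
  rewrite dotvZl dotvZr mulrA -expr2 sqr_sqrtr ?divr_ge0//.
  have [e|nz] := eqVneq (dotv x' x') 0; last by rewrite divfK.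
  by rewrite e mulr0; apply/eqP; rewrite eq_le y'0 -e y'x'.
have cx'p : dotv (c *: x') (ev p) = 0 by rewrite dotvZl perp_ev mulr0.
rewrite -(Phi_eq_norm r cx' cx'p (perp_ev y)).
have Hx t := H_scale r (x' *m fix_row p (M t)) c01.
have mx (x0 : 'rV[R]_n) :
    measurable_fun setT (fun t => (H r (x0 *m fix_row p (M t)))%:E).
  apply: measurable_H; apply: rand_mxM; first exact: rand_mx_cst.
  exact: rand_mx_fix_row.
rewrite /Phi; case: dir Hx => Hx; apply: ge0_le_integral => //=.
all: try by move=> t _; rewrite lee_fin.
all: by move=> t _; rewrite lee_fin -scalemxAl.
Qed.

Variable z : 'rV[R]_n.
Let u t : 'rV[R]_n := z *m (M t)^T.

Let mu : rand_mx u.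
Proof. by apply: rand_mxM; [exact: rand_mx_cst|exact: rand_mx_tr]. Qed.

Let integral_u_orth (Q : 'M[R]_n) (phi : 'rV[R]_n -> \bar R) :
  orthogonal_mx Q -> measurable_fun [set: mxT 1 n] phi -> (forall x, 0 <= phi x)%E ->
  (\int[P]_t phi (u t *m Q) = \int[P]_t phi (u t))%E.
Proof.
move=> oQ mphi phi0.
rewrite -(integral_haar (Q := Q^T) (phi := fun A : mxT n n => phi (z *m A^T)) haarM).
- by apply: eq_integral => t _; rewrite /u trmx_mul trmxK mulmxA.
- exact: orthogonal_trmx.
- apply: (measurableT_comp mphi); apply/rand_mxP; apply: rand_mxM.
    exact: rand_mx_cst.
  by apply: rand_mx_tr => i j; exact: measurable_coord.
- by [].
Qed.

Let Phi_ge0 r x : (0 <= Phi r x)%E.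
Proof. by apply: integral_ge0 => t _; rewrite lee_fin. Qed.

Let mfix (g : R -> R) r : measurable_fun setT g ->
  measurable_fun [set: T * T] (fun st : T * T =>
    (g (u st.1 0 p) * H r (u st.1 *m fix_row p (M st.2)))%:E).
Proof.
move=> mg; have mu1 : rand_mx (u \o fst : T * T -> _) by exact: rand_mx_comp.
apply/measurable_EFinP; apply: measurable_funM.
  by apply: (measurableT_comp mg); exact: mu1.
apply/measurable_EFinP; apply: measurable_H; apply: rand_mxM => //.
by apply: rand_mx_fix_row; exact: (rand_mx_comp mM measurable_snd).
Qed.

(** A second sample point [s] provides an independent copy of [M]. For fixed [s], multiplying [u] by
    [fix_row p (M s)] changes neither its law nor its p-th coordinate; Tonelli's theorem then moves
    the average over [s] inside, where it becomes [Phi]. *)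
Let resample (g : R -> R) r : measurable_fun setT g -> (forall x, 0 <= g x) ->
  (\int[P]_t (g (u t 0 p) * H r (u t))%:E =
   \int[P]_t ((g (u t 0 p))%:E * Phi r (u t)))%E.
Proof.
move=> mg g0.
transitivity (\int[P]_s \int[P]_t
    (g (u t 0 p) * H r (u t *m fix_row p (M s)))%:E)%E.
  transitivity (\int[P]_(s in setT) cst (\int[P]_t (g (u t 0 p) * H r (u t))%:E) s)%E.
    by rewrite integral_cst// [X in (_ * X)%E]probability_setT mule1.
  apply: eq_integral => s _ /=.
  rewrite -(@integral_u_orth (fix_row p (M s)) (fun x => (g (x 0 p) * H r x)%:E)).
  - by apply: eq_integral => t _; rewrite fix_row_coord.
  - exact: fix_row_orthogonal.
  - apply/measurable_EFinP; apply: measurable_funM.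
      by apply: (measurableT_comp mg); exact: measurable_coord.
    by apply/measurable_EFinP; apply: measurable_H => i j; exact: measurable_coord.
  - by move=> x; rewrite lee_fin mulr_ge0.
have := fubini_tonelli (m1 := P) (m2 := P) _ (mfix r mg) => <-; last first.
  by move=> x; rewrite lee_fin mulr_ge0.
apply: eq_integral => t _ /=.
under eq_integral do rewrite EFinM.
rewrite ge0_integralZl ?lee_fin//.
- apply: measurable_H; apply: rand_mxM; first exact: rand_mx_cst.
  exact: rand_mx_fix_row.
- by move=> s _; rewrite lee_fin.
Qed.

Lemma haar_coord_step r : p \notin r ->
  (\int[P]_t (h p (dotv (row p (M t)) z) *
               \prod_(j <- r) h j (dotv (row j (M t)) z))%:E <=
   (\int[P]_t (h p (dotv (row p (M t)) z))%:E) *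
   \int[P]_t (\prod_(j <- r) h j (dotv (row j (M t)) z))%:E)%E.
Proof.
move=> pr.
have uE j t : dotv (row j (M t)) z = u t 0 j.
  by rewrite mxE; apply: eq_bigr => i _; rewrite !mxE mulrC.
have HE t : \prod_(j <- r) h j (dotv (row j (M t)) z) = H r (u t).
  by apply: eq_bigr => j _; rewrite uE.
under eq_integral do rewrite uE HE.
under [X in (_ <= X * _)%E]eq_integral do rewrite uE.
under [X in (_ <= _ * X)%E]eq_integral do rewrite HE.
rewrite resample//.
(* Resampling with constant weight 1 identifies the means of [H r] and [Phi r]. *)
have -> : (\int[P]_t (H r (u t))%:E = \int[P]_t Phi r (u t))%E.
  transitivity (\int[P]_t (1 * H r (u t))%:E)%E.
    by apply: eq_integral => t _; rewrite mul1r.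
  rewrite (@resample (cst 1))//.
  by apply: eq_integral => t _; rewrite mul1e.
apply: integral_opposite => //.
- exact: measurableT_comp (mu 0 p).
- have m1 := mfix r (@measurable_cst _ _ R R setT 1).
  rewrite (_ : (fun t => Phi r (u t)) = fubini_F P (fun st : T * T =>
    (cst 1 (u st.1 0 p) * H r (u st.1 *m fix_row p (M st.2)))%:E)).
    by apply: measurable_fun_fubini_tonelli_F => // x; rewrite lee_fin mulr_ge0.
  by apply/funext => t; apply: eq_integral => s _ /=; rewrite mul1r.
(* All values of [u] have the norm of [z], so [Phi_mono] compares any two of them through the size
   of the p-th coordinate alone. *)
- move=> s t; have us q : dotv (u q) (u q) = dotv z z.
    by apply: dotv_orthogonal; exact: orthogonal_trmx.
  have ust a b : dotv (u a) (u a) = dotv (u b) (u b) by rewrite !us.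
  have [st|/ltW ts] := leP `|u s 0 p| `|u t 0 p|.
  + have := Phi_mono pr (ust s t) st; have := h_mono p st.
    by case: dir => h1 h2; [left|right].
  + have := Phi_mono pr (ust t s) ts; have := h_mono p ts.
    by case: dir => h1 h2; [right|left].
Qed.

End haar_block.

Section haar_coordinates.
Context {R : realType} {d : measure_display} {T : measurableType d}
  (P : probability T R) {n : nat} (M : T -> 'M[R]_n).

Lemma haar_coord_neg_dep (dir : bool) (h : 'I_n -> R -> R) (z : 'rV[R]_n) (r : seq 'I_n) :
  haar_orthogonal P M ->
  (forall j x, 0 <= h j x) -> (forall j, measurable_fun setT (h j)) ->
  (forall j x y, `|x| <= `|y| ->
    if dir then h j x <= h j y else h j y <= h j x) ->
  uniq r ->
  (\int[P]_t (\prod_(j <- r) h j (dotv (row j (M t)) z))%:E <=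
   \prod_(j <- r) \int[P]_t (h j (dotv (row j (M t)) z))%:E)%E.
Proof.
move=> haarM h0 mh hm.
elim: r => [_|p r IH /= /andP[pr ur]].
  under eq_integral do rewrite big_nil.
  by rewrite big_nil integral_cst// mul1e; exact: probability_le1.
rewrite big_cons; under [leLHS]eq_integral do rewrite big_cons.
apply: (le_trans (haar_coord_step haarM h0 mh hm z pr)).
apply: lee_wpmul2l; last exact: IH.
by apply: integral_ge0 => t _; rewrite lee_fin.
Qed.

End haar_coordinates.

Section haar_rows.
Context {R : realType} {d : measure_display} {T : measurableType d}
  (P : probability T R) {n : nat}.
Local Open Scope ereal_scope.

Lemma haar_rows_neg_dep (I : finType) (A : {pred I}) (pos : I -> 'I_n)
    (M : T -> 'M[R]_n) (dir : bool) (h : I -> R -> R) (z : 'rV[R]_n) :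
  haar_orthogonal P M -> {in A &, injective pos} ->
  (forall i x, (0 <= h i x)%R) -> (forall i, measurable_fun setT (h i)) ->
  (forall i x y, (`|x| <= `|y| ->
    if dir then h i x <= h i y else h i y <= h i x)%R) ->
  \int[P]_t (\prod_(i in A) h i (dotv (row (pos i) (M t)) z))%:E <=
  \prod_(i in A) \int[P]_t (h i (dotv (row (pos i) (M t)) z))%:E.
Proof.
move=> haarM posA h0 mh hm.
(* The functions reindexed by rows; a row not reached from [A] gets the constant 1, which is
   monotone in both directions. *)
pose h' j := if [pick i in A | pos i == j] is Some i then h i else cst 1%R.
have h'E i : i \in A -> h' (pos i) = h i.
  move=> iA; rewrite /h'; case: pickP => [k /andP[kA /eqP/(posA _ _ kA iA)->]//|].
  by move/(_ i); rewrite iA eqxx.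
pose r := [seq pos i | i <- enum A].
have ur : uniq r.
  by rewrite map_inj_in_uniq ?enum_uniq// => i j; rewrite !mem_enum; exact: posA.
under eq_integral => t _.
  rewrite (_ : \prod_(i in A) _ = \prod_(j <- r) h' j (dotv (row j (M t)) z))%R; last first.
    by rewrite big_map big_enum; apply: eq_bigr => i iA; rewrite h'E.
  over.
rewrite (_ : \prod_(i in A) _ =
    \prod_(j <- r) \int[P]_t (h' j (dotv (row j (M t)) z))%:E); last first.
  by rewrite big_map big_enum; apply: eq_bigr => i iA; rewrite h'E.
apply: (haar_coord_neg_dep (dir := dir) _ haarM) => // j.
- by move=> x; rewrite /h'; case: pickP => // _; exact: ler01.
- by rewrite /h'; case: pickP => [i _|_]; [exact: mh|exact: measurable_cst].
- move=> x y xy; rewrite /h'; case: pickP => [i _|_]; first exact: hm.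
  by case: ifP.
Qed.


(* Conjugating by a rotation carrying w to norm2 w times the p-th basis vector,
   then using the isotropy of w itself. *)
Lemma integral_scaled_haar_row (w : T -> 'rV[R]_n) (M : T -> 'M[R]_n) (l : T -> R)
    (p : 'I_n) (z : 'rV[R]_n) (phi : R -> \bar R) :
  rand_mx w ->
  (forall Q : 'M[R]_n, orthogonal_mx Q -> same_law_mx P (fun t => w t *m Q^T) w) ->
  haar_orthogonal P M -> measurable_fun setT l ->
  same_law P l (fun t => norm2 (w t)) ->
  measurable_fun setT phi -> (forall x, 0 <= phi x) ->
  \int[P]_s \int[P]_t phi (l s * dotv (row p (M t)) z)%R =
  \int[P]_t phi (dotv (w t) z).
Proof.
move=> mw isow haarM ml lw mphi phi0; have [mM [oM _]] := haarM.
have mrow : measurable_fun setT (fun t => dotv (row p (M t)) z).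
  apply: measurable_dotv; last exact: rand_mx_cst.
  by move=> i j; under eq_fun do rewrite mxE; exact: mM.
pose kappa r := \int[P]_t phi (r * dotv (row p (M t)) z)%R.
have mkappa : measurable_fun setT kappa.
  apply: (measurable_fun_fubini_tonelli_F (m2 := P)
    (fun x : R * T => phi (x.1 * dotv (row p (M x.2)) z)%R)) => //.
  apply: (measurableT_comp mphi); apply: measurable_funM => //.
  exact: (measurableT_comp mrow).
have kappa0 r : 0 <= kappa r by exact: integral_ge0.
have mnorm : measurable_fun setT (fun t => norm2 (w t)).
  rewrite (_ : (fun t => _) = fun t => ((\sum_i w t 0 i ^+ 2) `^ 2^-1)%R).
    apply: (measurableT_comp (measurable_powR _)).
    by apply: measurable_sum => i; apply: measurable_funX; exact: mw.
  apply/funext => t; rewrite powR12_sqrt// sumr_ge0// => i _; exact: sqr_ge0.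
rewrite (integral_same_law (X := l) ml mnorm lw mkappa kappa0).
have kE x : kappa (norm2 x) = \int[P]_t phi (dotv (x *m M t) z).
  have [Q oQ xQ] := row_of_norm x p.
  rewrite /kappa -(integral_haar (Q := Q)
    (phi := fun A : mxT n n => phi (norm2 x * dotv (row p A) z)%R) haarM oQ).
  - by apply: eq_integral => t _; rewrite [in RHS]xQ -scalemxAl dotvZl rowE mulmxA.
  - apply: (measurableT_comp mphi); apply: measurable_funM => //.
    apply: measurable_dotv; last exact: rand_mx_cst.
    by move=> i j; under eq_fun do rewrite mxE; exact: measurable_coord.
  - by [].
under eq_integral do rewrite kE.
rewrite (fubini_tonelli (m1 := P) (m2 := P)
  (fun x : T * T => phi (dotv (w x.1 *m M x.2) z)))//; last first.
  apply: (measurableT_comp mphi); apply: measurable_dotv; last exact: rand_mx_cst.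
  apply: rand_mxM; first exact: (rand_mx_comp mw measurable_fst).
  exact: (rand_mx_comp mM measurable_snd).
(* After the exchange, [w] is integrated first: [M t] is then a fixed orthogonal matrix, which
   isotropy removes, leaving an integrand constant in [t]. *)
transitivity (\int[P]_(t in setT) cst (\int[P]_s phi (dotv (w s) z)) t); last first.
  by rewrite integral_cst// [X in _ * X]probability_setT mule1.
apply: eq_integral => t _ /=.
rewrite -[M t]trmxK.
apply: (integral_same_law_mx (phi := fun A : mxT 1 n => phi (dotv A z))) => //.
- by apply: rand_mxM => //; exact: rand_mx_cst.
- by apply: isow; apply: orthogonal_trmx.
- apply: (measurableT_comp mphi); apply: measurable_dotv; last exact: rand_mx_cst.
  by move=> i j; exact: measurable_coord.
Qed.

End haar_rows.

(** * The block-orthogonal ensemble *)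

Lemma lee_prod_ge0 (R : realType) (I : Type) (r : seq I) (A : pred I) (a b : I -> \bar R) :
  (forall i, A i -> 0 <= a i <= b i)%E ->
  (\prod_(i <- r | A i) a i <= \prod_(i <- r | A i) b i)%E.
Proof.
move=> ab; suff /andP[] : (0 <= \prod_(i <- r | A i) a i <=
  \prod_(i <- r | A i) b i)%E by [].
apply: (big_ind2 (fun x y : \bar R => 0 <= x <= y)%E) => //.
  by rewrite lee01 lexx.
move=> x x' y y' /andP[x0 xx'] /andP[y0 yy'].
by rewrite mule_ge0// lee_pmul.
Qed.

Section event_systems.
Context {R : realType} {d : measure_display} {T : measurableType d}.

Lemma events_mx_measurable m n (X : T -> 'M[R]_(m, n)) :
  rand_mx X -> events_mx X `<=` measurable.
Proof.
move=> /rand_mxP mX _ [A mA ->].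
by have := mX measurableT A mA; rewrite setTI.
Qed.

Lemma events_mx_setI m n (X : T -> 'M[R]_(m, n)) : setI_closed (events_mx X).
Proof.
move=> _ _ [A mA ->] [B mB ->]; exists (A `&` B) => //.
exact: (@measurableI _ (mxT m n)).
Qed.

Lemma events_mx_setT m n (X : T -> 'M[R]_(m, n)) : events_mx X setT.
Proof. by exists setT => //; exact: (@measurableT _ (mxT m n)). Qed.

Lemma events_mx_comp m n (X : T -> 'M[R]_(m, n)) d' (U : measurableType d')
    (phi : mxT m n -> U) (B : set U) :
  measurable_fun setT phi -> measurable B -> events_mx X ((phi \o X) @^-1` B).
Proof.
move=> mphi mB; exists (phi @^-1` B); last by [].
by have := mphi measurableT B mB; rewrite setTI.
Qed.

Lemma events_measurable (X : T -> R) :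
  measurable_fun setT X -> events X `<=` measurable.
Proof. by move=> mX _ [A mA ->]; have := mX measurableT A mA; rewrite setTI. Qed.

Lemma events_setI (X : T -> R) : setI_closed (events X).
Proof.
by move=> _ _ [A mA ->] [B mB ->]; exists (A `&` B) => //; exact: measurableI.
Qed.

Lemma events_setT (X : T -> R) : events X setT.
Proof. by exists setT. Qed.

Lemma events_comp (X : T -> R) d' (U : measurableType d') (phi : R -> U) (B : set U) :
  measurable_fun setT phi -> measurable B -> events X ((phi \o X) @^-1` B).
Proof.
move=> mphi mB; exists (phi @^-1` B); last by [].
by have := mphi measurableT B mB; rewrite setTI.
Qed.

End event_systems.

Section ensemble.
Context {R : realType} {d : measure_display} {T : measurableType d}
  (P : probability T R) (dim s nb : nat).
Variables (w : T -> 'rV[R]_dim) (z : 'rV[R]_dim).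
Variables (M : 'I_nb -> T -> 'M[R]_dim) (l : 'I_s -> T -> R).
Variables (blk : 'I_s -> 'I_nb) (pos : 'I_s -> 'I_dim).
Hypothesis mw : rand_mx w.
Hypothesis isow : forall Q : 'M[R]_dim, orthogonal_mx Q ->
  same_law_mx P (fun t => w t *m Q^T) w.
Hypothesis inj_blkpos : injective (fun i => (blk i, pos i)).
Hypothesis haarM : forall b, haar_orthogonal P (M b).
Hypothesis lawl : forall i,
  measurable_fun setT (l i) /\ same_law P (l i) (fun t => norm2 (w t)).
Let F (k : 'I_nb + 'I_s) : set (set T) :=
  match k with inl b => events_mx (M b) | inr i => events (l i) end.
Hypothesis indF : mutually_indep P F.
Local Open Scope ereal_scope.

Let Fm k : F k `<=` measurable.
Proof.
case: k => [b|i] /=; first exact: events_mx_measurable (haarM b).1.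
exact: events_measurable (lawl i).1.
Qed.

Let FI k : setI_closed (F k).
Proof. by case: k => [b|i] /=; [exact: events_mx_setI|exact: events_setI]. Qed.

Let FT k : F k setT.
Proof. by case: k => [b|i] /=; [exact: events_mx_setT|exact: events_setT]. Qed.

Let row_dot i t : R := dotv (row (pos i) (M (blk i) t)) z.

Let G (J : {set 'I_nb + 'I_s}) : measurableType (sigma_display (rects F J)) :=
  g_sigma_algebraType (rects F J).
Let Jl : {set 'I_nb + 'I_s} := [set inr i | i : 'I_s].
Let JM : {set 'I_nb + 'I_s} := [set inl b | b : 'I_nb].

Let measurable_row_dot d' (U : measurableType d') (X : U -> 'M[R]_dim) p :
  rand_mx X -> measurable_fun setT (fun t => dotv (row p (X t)) z).
Proof.
move=> mX; apply: measurable_dotv; last exact: rand_mx_cst.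
by move=> i j; under eq_fun do rewrite mxE; exact: mX.
Qed.

Let ml i : measurable_fun [set: G Jl] (l i).
Proof.
apply: (measurable_fun_rects FT (i := inr i)); first exact: imset_f.
by move=> B mB; exists B.
Qed.

Let mrow i : measurable_fun [set: G JM] (row_dot i).
Proof.
apply: (@measurable_row_dot _ (G JM) (M (blk i))).
apply/(rand_mxP (T := G JM)).
apply: (measurable_fun_rects FT (i := inl (blk i))); first exact: imset_f.
by move=> B mB; exists B.
Qed.

(** The lengths are read at the first sample point and the Haar matrices at the second. *)
Let decouple (phi : G Jl * G JM -> \bar R) :
  measurable_fun setT phi -> (forall x, 0 <= phi x) ->
  \int[P]_t phi (t, t) = \int[P]_x \int[P]_y phi (x, y).
Proof.
apply: integral_decouple_rects => //.
by move=> k /imsetP[i _ ->]; apply/imsetP => -[].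
Qed.

(** A single orthogonal sample has the same projection on [z], in law, as [w]: its length is
    decoupled from its Haar row. *)
Lemma integral_ort_sample i (phi : R -> \bar R) :
  measurable_fun setT phi -> (forall x, 0 <= phi x) ->
  \int[P]_t phi (dotv (l i t *: row (pos i) (M (blk i) t)) z) =
  \int[P]_t phi (dotv (w t) z).
Proof.
move=> mphi phi0; have [mli lawli] := lawl i.
rewrite -(integral_scaled_haar_row (pos i) z mw isow (haarM (blk i)) mli lawli mphi phi0).
under eq_integral do rewrite dotvZl.
rewrite (decouple (phi := fun x => phi (l i x.1 * row_dot i x.2)%R))//.
apply: (measurableT_comp mphi); apply: measurable_funM.
  exact: (measurableT_comp (ml i) measurable_fst).
exact: (measurableT_comp (mrow i) measurable_snd).
Qed.

(** With the lengths frozen at [x], the blocks are independent and each is negatively dependent,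
    which bounds the conditional mean by a product of the [kappa i (l i x)]. Independence of the
    lengths then factors the mean of this product. *)
Lemma ort_samples_neg_dep (dir : bool) (h : 'I_s -> R -> R) :
  (forall i x, (0 <= h i x)%R) -> (forall i, measurable_fun setT (h i)) ->
  (forall i x y, (`|x| <= `|y| ->
    if dir then h i x <= h i y else h i y <= h i x)%R) ->
  \int[P]_t (\prod_i h i (dotv (l i t *: row (pos i) (M (blk i) t)) z))%:E <=
  \prod_i \int[P]_t (h i (dotv (w t) z))%:E.
Proof.
move=> h0 mh hm.
pose kappa i r := \int[P]_y (h i (r * row_dot i y)%R)%:E.
have kappa0 i r : 0 <= kappa i r by apply: integral_ge0 => y _; rewrite lee_fin.
have mrowT i : measurable_fun [set: T] (row_dot i).
  by apply: measurable_row_dot; exact: (haarM _).1.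
have mkappa i : measurable_fun setT (kappa i).
  apply: (measurable_fun_fubini_tonelli_F (m2 := P)
    (fun x : R * T => (h i (x.1 * row_dot i x.2)%R)%:E)).
  - apply/measurable_EFinP; apply: (measurableT_comp (mh i)).
    by apply: measurable_funM => //; exact: (measurableT_comp (mrowT i)).
  - by move=> x; rewrite lee_fin.
have -> : \prod_i \int[P]_t (h i (dotv (w t) z))%:E = \prod_i \int[P]_t kappa i (l i t).
  apply: eq_bigr => i _; have [mli lawli] := lawl i.
  rewrite -(@integral_scaled_haar_row _ _ _ P _ w (M (blk i)) (l i) (pos i) z
    (EFin \o h i))//.
  - exact/measurable_EFinP.
  - by move=> x; rewrite lee_fin.
(* Within a block all rows come from the same matrix [M b], at distinct positions by
   [inj_blkpos]. *)
have block x b :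
    \int[P]_y (\prod_(i | blk i == b) h i (l i x * row_dot i y)%R)%:E <=
    \prod_(i | blk i == b) kappa i (l i x).
  rewrite /kappa /row_dot.
  under eq_integral => y _.
    rewrite (eq_bigr (fun i => h i (l i x * dotv (row (pos i) (M b y)) z)))%R;
      last by move=> i /eqP->.
    over.
  rewrite [leRHS](eq_bigr (fun i =>
    \int[P]_y (h i (l i x * dotv (row (pos i) (M b y)) z)%R)%:E)); last first.
    by move=> i /eqP->.
  apply: (@haar_rows_neg_dep _ _ _ P _ _ [pred i | blk i == b] pos (M b) dir
    (fun i u => h i (l i x * u)%R)) => //.
  - move=> i j; rewrite !inE => /eqP bi /eqP bj pij.
    by apply: inj_blkpos; rewrite bi bj pij.
  - by move=> i; apply: (measurableT_comp (mh i)); exact: measurable_funM.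
  (* Multiplication by a fixed length, whatever its sign, preserves comparisons of absolute
     values. *)
  - by move=> i u v uv; apply: hm; rewrite !normrM ler_wpM2l.
have inner x : \int[P]_y (\prod_i h i (l i x * row_dot i y)%R)%:E <=
    \prod_i kappa i (l i x).
  (* Padding by 1 at the length indices gives a family over the full index type, as [indF] requires;
     the roles are swapped below for the lengths. *)
  pose Y (k : 'I_nb + 'I_s) y : \bar R := if k is inl b
    then (\prod_(i | blk i == b) h i (l i x * row_dot i y)%R)%:E else 1.
  have mblk b : measurable_fun [set: mxT dim dim] (fun A : 'M[R]_dim =>
      (\prod_(i | blk i == b) h i (l i x * dotv (row (pos i) A) z)%R)%:E).
    apply/measurable_EFinP.
    rewrite (_ : (fun A => _) = fun A : mxT dim dim =>
      (\prod_(i <- [seq i <- index_enum 'I_s | blk i == b])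
         h i (l i x * dotv (row (pos i) A) z))%R); last first.
      by apply/funext => A; rewrite big_filter.
    apply: measurable_prod => i _; apply: (measurableT_comp (mh i)).
    apply: measurable_funM => //; apply: measurable_row_dot => ? ?.
    exact: measurable_coord.
  under eq_integral => y _.
    rewrite (_ : (\prod_i _)%:E = \prod_k Y k y); last first.
      rewrite big_sumType/= [X in _ * X]big1// mule1 prodEFin.
      by congr EFin; exact: partition_big.
    over.
  rewrite (integral_prod_indep Fm FI FT indF).
  - rewrite big_sumType/= [X in _ * X]big1 ?mule1; last first.
      by move=> i _; rewrite integral_cst// mul1e; exact: probability_setT.
    rewrite [leRHS](partition_big blk xpredT)//=.
    by apply: lee_prod_ge0 => b _; rewrite block integral_ge0// => y _;
      rewrite lee_fin prodr_ge0.
  - by move=> [b|i] y /=; rewrite ?lee_fin ?prodr_ge0.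
  - move=> [b|i] B mB; last first.
      by apply: events_comp (measurable_cst _) mB.
    have -> : Y (inl b) = (fun A : 'M[R]_dim =>
        (\prod_(i | blk i == b) h i (l i x * dotv (row (pos i) A) z)%R)%:E) \o M b.
      apply/funext => y; congr EFin; apply: eq_bigr => i /eqP bi.
      by rewrite /row_dot bi.
    exact: events_mx_comp (mblk b) mB.
rewrite (_ : \prod_i _ = \int[P]_x \prod_i kappa i (l i x)); last first.
  pose Y (k : 'I_nb + 'I_s) x : \bar R := if k is inr i then kappa i (l i x) else 1.
  under eq_integral => x _.
    rewrite (_ : \prod_i _ = \prod_k Y k x); last first.
      by rewrite big_sumType/= [X in X * _]big1// mul1e.
    over.
  rewrite (integral_prod_indep Fm FI FT indF).
  - rewrite big_sumType/= [X in X * _]big1 ?mul1e// => i _.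
    by rewrite integral_cst// mul1e; exact: probability_setT.
  - by move=> [b|i] y /=.
  - move=> [b|i] B mB /=; last exact: events_comp (mkappa i) mB.
    by apply: events_mx_comp (measurable_cst _) mB.
under eq_integral do under eq_bigr do rewrite dotvZl.
rewrite (decouple (phi := fun x => (\prod_i h i (l i x.1 * row_dot i x.2)%R)%:E)).
- apply: ge0_le_integral => //.
  + by move=> x _; apply: integral_ge0 => y _; rewrite lee_fin prodr_ge0.
  + apply: (measurable_fun_fubini_tonelli_F (m2 := P)
      (fun x : T * T => (\prod_i h i (l i x.1 * row_dot i x.2)%R)%:E)).
      apply/measurable_EFinP; apply: measurable_prod => i _.
      apply: (measurableT_comp (mh i)); apply: measurable_funM.
        exact: (measurableT_comp (lawl i).1 measurable_fst).
      exact: (measurableT_comp (mrowT i) measurable_snd).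
    by move=> x; rewrite lee_fin prodr_ge0.
  + apply: emeasurable_bigprod => i _; apply: (measurableT_comp (mkappa i)).
    exact: (lawl i).1.
  + by move=> x _; exact: inner.
- apply/measurable_EFinP; apply: measurable_prod => i _.
  apply: (measurableT_comp (mh i)); apply: measurable_funM.
    exact: (measurableT_comp (ml i) measurable_fst).
  exact: (measurableT_comp (mrow i) measurable_snd).
- by move=> x; rewrite lee_fin prodr_ge0.
Qed.

End ensemble.

(** * Hoeffding's lemma *)

Section hoeffding.
Import numFieldNormedType.Exports.
Context {R : realType}.

Lemma derive_nonneg (f df : R -> R) :
  (forall x : R, is_derive x (1 : R) f (df x)) -> f 0 = 0 ->
  (forall x, 0 <= x -> 0 <= df x) -> forall t, 0 <= t -> 0 <= f t.
Proof.
move=> fdf f0 df0 t t0.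
have cf : {within `[0, t], continuous f}.
  by apply: derivable_within_continuous => x _; apply: ex_derive.
have [c] := MVT_segment t0 (fun x _ => fdf x) cf.
rewrite f0 !subr0 in_itv/= => /andP[c0 _] ->.
by rewrite mulr_ge0// df0.
Qed.

(** [D] is the Bernoulli moment generating function and [q] the tilted success probability. The gap
    [phi] between the exponents vanishes at 0 with its derivative [phi1], and its second derivative
    1/4 - q (1 - q) is the square of q - 1/2. *)
Let bernoulli_mgf_pos (p t : R) : 0 <= p <= 1 -> 0 <= t ->
  1 - p + p * expR t <= expR (p * t + t ^+ 2 / 8).
Proof.
move=> /andP[p0 p1] t0.
pose D x := 1 - p + p * expR x.
have D_gt0 x : 0 < D x.
  rewrite /D; have [->|pn0] := eqVneq p 0; first by rewrite mul0r subr0 addr0.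
  by rewrite ltr_wpDl ?subr_ge0// mulr_gt0 ?expR_gt0// lt_neqAle eq_sym pn0.
have DD x : is_derive x (1 : R) D (p * expR x).
  by apply: is_derive_eq; rewrite ?scaler0 ?add0r ?addr0 /GRing.scale/= mul1r.
pose q x := p * expR x / D x.
pose phi1 x := p + x / 4 - q x.
have dphi1 x : is_derive x (1 : R) phi1 (4^-1 - q x * (1 - q x)).
  have Dx := lt0r_neq0 (D_gt0 x).
  have dV := is_deriveV Dx (DD x).
  rewrite /phi1 /q.
  apply: is_derive_eq.
  by rewrite /GRing.scale/=; field.
have phi1_ge0 x : 0 <= x -> 0 <= phi1 x.
  apply: (derive_nonneg dphi1); last first.
    move=> y _; have := sqr_ge0 (q y - 2^-1); lra.
  by rewrite /phi1 /q /D expR0 mulr1 subrK divr1 mul0r addr0 subrr.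
pose phi x := p * x + x ^+ 2 / 8 - ln (D x).
have dphi x : is_derive x (1 : R) phi (phi1 x).
  have dl := is_derive1_comp (is_derive1_ln (D_gt0 x)) (DD x).
  rewrite /phi.
  apply: is_derive_eq.
  by rewrite /phi1 /q /GRing.scale/=; field; exact: lt0r_neq0.
have : 0 <= phi t.
  apply: (derive_nonneg dphi _ phi1_ge0 t0).
  by rewrite /phi /D expR0 !mulr1 subrK ln1 mulr0 expr0n mul0r addr0 subrr.
by rewrite subr_ge0 -ler_expR lnK// posrE.
Qed.

Lemma bernoulli_mgf (p t : R) : 0 <= p <= 1 ->
  1 - p + p * expR t <= expR (p * t + t ^+ 2 / 8).
Proof.
move=> p01; have [t0|t0] := leP 0 t; first exact: bernoulli_mgf_pos.
(* For negative [t], success and failure are exchanged, and a factor [expR t] restores the original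
   expression. *)
have p'01 : 0 <= 1 - p <= 1 by lra.
have t'0 : 0 <= - t by lra.
have := ler_wpM2l (expR_ge0 t) (bernoulli_mgf_pos p'01 t'0).
rewrite -expRD => H.
apply: le_trans (le_trans H _).
  by rewrite mulrDr mulrCA -expRD subrr expR0; lra.
by rewrite ler_expR; lra.
Qed.

(** The tangent at the barycentre [m] lies below the exponential at both [u] and [v]. *)
Lemma expR_chord (u v c : R) : 0 <= c <= 1 ->
  expR (c * u + (1 - c) * v) <= c * expR u + (1 - c) * expR v.
Proof.
move=> /andP[c0 c1]; set m := c * u + (1 - c) * v.
have eE x : expR m * (1 + (x - m)) <= expR x.
  rewrite (_ : expR x = expR m * expR (x - m)); last by rewrite -expRD addrC subrK.
  rewrite ler_pM2l ?expR_gt0//.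
  exact: expR_ge1Dx.
have hu := ler_wpM2l c0 (eE u).
have c10 : 0 <= 1 - c by rewrite subr_ge0.
have hv := ler_wpM2l c10 (eE v).
have := lerD hu hv; apply: le_trans.
by rewrite le_eqVlt; apply/orP; left; apply/eqP; rewrite /m; ring.
Qed.

Context {d : measure_display} {T : measurableType d} (P : probability T R).

Lemma hoeffding_lemma (X : T -> R) (a b theta : R) :
  P.-integrable setT (EFin \o X) -> a < b -> (forall t, a <= X t <= b) ->
  (mgf P X theta <= (expR (theta * fine (expect P X) +
    theta ^+ 2 * (b - a) ^+ 2 / 8))%:E)%E.
Proof.
move=> iX ab Xab; have ba : 0 < b - a by rewrite subr_gt0.
have mX : measurable_fun setT X by apply/measurable_EFinP; exact: (measurable_int P).
set m := fine (expect P X).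
have mE : expect P X = m%:E by rewrite fineK//; exact: integrable_fin_num.
(* [al] and [be] are the intercept and slope of the chord of x -> exp(theta x) over [a, b]. The mean
   of the chord depends only on [m] and equals exp(theta a) times a Bernoulli moment generating
   function with parameter (m - a) / (b - a). *)
pose al := expR (theta * a) - a / (b - a) * (expR (theta * b) - expR (theta * a)).
pose be := (expR (theta * b) - expR (theta * a)) / (b - a).
have chord t : expR (theta * X t) <= al + be * X t.
  have c01 : 0 <= (X t - a) / (b - a) <= 1.
    have /andP[h1 h2] := Xab t.
    by rewrite divr_ge0 ?subr_ge0 ?(ltW ab)//= ler_pdivrMr// mul1r lerB.
  have := expR_chord (theta * b) (theta * a) c01.
  rewrite (_ : (X t - a) / (b - a) * (theta * b) + _ = theta * X t); last first.
    by field; rewrite subr_eq0 gt_eqF.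
  move=> /le_trans; apply; rewrite le_eqVlt; apply/orP; left; apply/eqP.
  by rewrite /al /be; field; rewrite subr_eq0 gt_eqF.
have iaff : (\int[P]_t (al + be * X t)%:E = (al + be * m)%:E)%E.
  rewrite (_ : (fun t => _) = (fun t => (cst al%:E t + be%:E * (X t)%:E)%E)); last first.
    by apply/funext => t; rewrite EFinD EFinM.
  rewrite integralD//.
  - rewrite integralZl// [X in (_ + _ * X)%E]mE integral_cst//.
    by rewrite [X in (_ * X + _)%E]probability_setT mule1 EFinD EFinM.
  - exact: finite_measure_integrable_cst.
  - exact: integrableZl.
have : (mgf P X theta <= (al + be * m)%:E)%E.
  rewrite -iaff; apply: ge0_le_integral => //.
  - apply/measurable_EFinP; apply: (measurableT_comp (@measurable_expR R)).
    exact: measurable_funM.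
  - apply/measurable_EFinP; apply: measurable_funD => //.
    exact: measurable_funM.
  - by move=> t _; rewrite lee_fin chord.
move=> /le_trans; apply; rewrite lee_fin.
have mab : a <= m <= b.
  have icst (c : R) : (\int[P]_t (c%:E) = c%:E)%E.
    by rewrite integral_cst// [X in (_ * X)%E]probability_setT mule1.
  have iac (c : R) : P.-integrable setT (cst c%:E) by exact: finite_measure_integrable_cst.
  rewrite -!lee_fin -mE -(icst a) -(icst b); apply/andP; split.
    apply: le_integral => //; first exact: iac.
    by move=> t _; rewrite lee_fin; have /andP[] := Xab t.
  apply: le_integral => //; first exact: iac.
  by move=> t _; rewrite lee_fin; have /andP[] := Xab t.
have p01 : 0 <= (m - a) / (b - a) <= 1.
  have /andP[h1 h2] := mab.
  by rewrite divr_ge0 ?subr_ge0 ?(ltW ab)//= ler_pdivrMr// mul1r lerB.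
have := ler_wpM2l (expR_ge0 (theta * a)) (bernoulli_mgf (theta * (b - a)) p01).
rewrite -expRD => H.
apply: le_trans (le_trans H _); last first.
  rewrite ler_expR le_eqVlt; apply/orP; left; apply/eqP.
  by field; rewrite subr_eq0 gt_eqF.
rewrite mulrDr mulrCA -expRD.
rewrite (_ : theta * a + theta * (b - a) = theta * b); last by ring.
rewrite le_eqVlt; apply/orP; left; apply/eqP.
by rewrite /al /be; field; rewrite subr_eq0 gt_eqF.
Qed.

End hoeffding.

(** * Tail bounds and mean squared error *)

Section chernoff.
Context {R : realType} {d : measure_display} {T : measurableType d}
  (P : probability T R).
Local Open Scope ereal_scope.

Lemma mgf_ge0 (X : T -> R) theta : 0 <= mgf P X theta.
Proof. by apply: integral_ge0 => t _; rewrite lee_fin expR_ge0. Qed.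

(** Markov's inequality for exp(theta S); the sign of [theta] is left free so that it serves both
    tails. *)
Lemma chernoff_le (S : T -> R) (E : set T) (theta c : R) :
  measurable_fun setT S -> measurable E ->
  (forall t, E t -> (c <= theta * S t)%R) ->
  P E <= (expR (- c))%:E * mgf P S theta.
Proof.
move=> mS mE cS.
have mexp : measurable_fun setT (fun t => (expR (theta * S t))%:E).
  apply/measurable_EFinP; apply: (measurableT_comp (@measurable_expR R)).
  exact: measurable_funM.
have -> : P E = (expR (- c))%:E * ((expR c)%:E * P E).
  by rewrite muleA -EFinM -expRD addNr expR0 mul1e.
apply: lee_wpmul2l; first by rewrite lee_fin expR_ge0.
rewrite -integral_cst//; apply: (@le_trans _ _ (\int[P]_(t in E) (expR (theta * S t))%:E)).
  apply: ge0_le_integral => //.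
  - by move=> t _; rewrite lee_fin expR_ge0.
  - exact: measurable_funTS.
  - by move=> t Et; rewrite lee_fin ler_expR cS.
by apply: ge0_subset_integral => // t _; rewrite lee_fin expR_ge0.
Qed.

Lemma chernoff_legendre_term (X : T -> R) (n : nat) (a theta : R) (p : \bar R) :
  (0 < n)%N -> p <= 1 ->
  p <= (expR (- (theta * (n%:R * a))))%:E * mgf P X theta ^+ n ->
  p <= expeR (- (n%:R%:E * legendre_term P X a theta)).
Proof.
move=> n0 p1; rewrite /legendre_term.
have npos : (0 < n%:R :> R)%R by rewrite ltr0n.
(* An infinite moment generating function makes the bound infinite. The value 0 gives [ln 0 = 0] by
   default, hence the bound 1. *)
case: (mgf P X theta) (mgf_ge0 X theta) => [r| |]//; last first.
  by move=> _ _; rewrite gt0_muleNy ?lte_fin//= leey.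
rewrite lee_fin le_eqVlt => /predU1P[<- _|r0].
  by rewrite invr0 mulr0 ln0// mule0 oppe0 expeR0.
move=> /le_trans; apply.
rewrite -EFin_expe -EFinM/= lee_fin ln_div ?posrE ?expR_gt0// expRK.
rewrite -[in X in (_ * X ^+ n)%R](lnK r0) -expRM_natl -expRD ler_expR.
by rewrite mulrBr opprB addrC mulrCA.
Qed.

(** For [0 < p], logarithms turn each bound into x <= - ln p / n, which passes to the supremum;
    [p = 0] is treated apart. *)
Lemma le_expeR_sup (n : nat) (S : set \bar R) (p : R) :
  (0 < n)%N -> (0 <= p)%R ->
  (forall x, S x -> p%:E <= expeR (- (n%:R%:E * x))) ->
  p%:E <= expeR (- (n%:R%:E * ereal_sup S)).
Proof.
move=> n0; rewrite le_eqVlt => /predU1P[<- _|p0 pS]; first exact: expeR_ge0.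
have npos : (0 < n%:R :> R)%R by rewrite ltr0n.
have pE : p%:E = expeR (ln p)%:E by rewrite /= lnK// posrE.
rewrite pE lee_expeR leeNr -EFinN.
have e : (- ln p)%:E = n%:R%:E * ((- ln p) / n%:R)%:E.
  by rewrite -EFinM mulrC divfK// gt_eqF.
rewrite e; apply: lee_wpmul2l; first by rewrite lee_fin ltW.
apply: ge_ereal_sup => x /pS.
by rewrite pE lee_expeR leeNr -EFinN e lee_pmul2l.
Qed.

End chernoff.

Section mean_squared_error.
Context {R : realType} {d : measure_display} {T : measurableType d}
  (P : probability T R).
Local Open Scope ereal_scope.

(** The bias-variance identity, with [m ^+ 2] added on the left so that no possibly infinite second
    moment is subtracted. *)
Let square_mean (n : nat) (V : 'I_n -> T -> R) (m : R) :
  (0 < n)%N ->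
  (forall i t, 0 <= V i t)%R -> (forall i, measurable_fun setT (V i)) ->
  (forall i, \int[P]_t (V i t)%:E = m%:E) ->
  \int[P]_t ((n%:R^-1 * \sum_i V i t - m) ^+ 2)%:E + (m ^+ 2)%:E =
  ((n%:R^-1) ^+ 2)%:E * \sum_i \sum_j \int[P]_t (V i t * V j t)%:E.
Proof.
move=> n0 V0 mV Vm.
have m0 : (0 <= m)%R.
  rewrite -lee_fin -(Vm (Ordinal n0)); apply: integral_ge0 => t _.
  by rewrite lee_fin.
have nn0 : (n%:R != 0 :> R)%R by rewrite pnatr_eq0 -lt0n.
pose S t := (\sum_i V i t)%R.
have mS : measurable_fun setT S by exact: measurable_sum.
have S0 t : (0 <= S t)%R by exact: sumr_ge0.
have IS : \int[P]_t (S t)%:E = (n%:R * m)%:E.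
  under eq_integral do rewrite -sumEFin.
  rewrite ge0_integral_sum//.
  - under eq_bigr do rewrite Vm.
    by rewrite sumEFin sumr_const card_ord mulr_natl.
  - by move=> i; apply/measurable_EFinP.
  - by move=> i t _; rewrite lee_fin.
have IS2 : \int[P]_t (S t ^+ 2)%:E = \sum_i \sum_j \int[P]_t (V i t * V j t)%:E.
  transitivity (\int[P]_t (\sum_i \sum_j (V i t * V j t)%:E)).
    apply: eq_integral => t _; rewrite expr2 /S mulr_suml -sumEFin.
    by apply: eq_bigr => i _; rewrite mulr_sumr -sumEFin.
  have mVV i j : measurable_fun setT (fun t => (V i t * V j t)%:E).
    by apply/measurable_EFinP; exact: measurable_funM.
  rewrite ge0_integral_sum//.
  - apply: eq_bigr => i _; rewrite ge0_integral_sum// => j t _.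
    by rewrite lee_fin mulr_ge0.
  - by move=> i; exact: emeasurable_sum.
  - by move=> i t _; apply: sume_ge0 => j _; rewrite lee_fin mulr_ge0.
have icst (c : R) : \int[P]_t (cst c%:E) t = c%:E.
  by rewrite integral_cst// [X in _ * X]probability_setT mule1.
have mS2 : measurable_fun setT (fun t => (S t ^+ 2)%:E).
  by apply/measurable_EFinP; exact: measurable_funX.
have mS1 : measurable_fun setT (fun t => (S t)%:E) by exact/measurable_EFinP.
(* (S / n - m)^2 + 2 m S / n = S^2 / n^2 + m^2, where every term is nonnegative
   so that no integrability is needed. *)
have key : \int[P]_t ((n%:R^-1 * S t - m) ^+ 2)%:E + (2 * m ^+ 2)%:E =
    ((n%:R^-1) ^+ 2)%:E * \int[P]_t (S t ^+ 2)%:E + (m ^+ 2)%:E.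
  transitivity (\int[P]_t (((n%:R^-1 * S t - m) ^+ 2)%:E +
                           (2 * m / n%:R)%:E * (S t)%:E)).
    rewrite ge0_integralD//.
    - rewrite ge0_integralZl//; last 2 first.
      + by move=> t _; rewrite lee_fin.
      + by rewrite lee_fin divr_ge0// mulr_ge0.
      by rewrite IS -EFinM; congr (_ + _%:E); field.
    - by move=> t _; rewrite lee_fin sqr_ge0.
    - apply/measurable_EFinP; apply: measurable_funX; apply: measurable_funB => //.
      exact: measurable_funM.
    - by move=> t _; rewrite mule_ge0 ?lee_fin ?divr_ge0// mulr_ge0.
    - exact: emeasurable_funM.
  transitivity (\int[P]_t (((n%:R^-1) ^+ 2)%:E * (S t ^+ 2)%:E + (m ^+ 2)%:E)).
    by apply: eq_integral => t _; rewrite -!EFinM -!EFinD; congr EFin; field.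
  rewrite ge0_integralD//.
  - by rewrite icst ge0_integralZl// => *; rewrite lee_fin sqr_ge0.
  - by move=> t _; rewrite mule_ge0// lee_fin sqr_ge0.
  - exact: emeasurable_funM.
  - by move=> t _; rewrite lee_fin sqr_ge0.
move: key; rewrite IS2 mulr2n mulrDl mul1r EFinD addeA.
by move/(congr1 (fun x => x - (m ^+ 2)%:E)); rewrite !addeK.
Qed.

Lemma le_mse_mean (n : nat) (V W : 'I_n -> T -> R) (m : R) :
  (0 < n)%N ->
  (forall i t, 0 <= V i t)%R -> (forall i t, 0 <= W i t)%R ->
  (forall i, measurable_fun setT (V i)) -> (forall i, measurable_fun setT (W i)) ->
  (forall i, \int[P]_t (V i t)%:E = m%:E) ->
  (forall i, \int[P]_t (W i t)%:E = m%:E) ->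
  (forall i j, \int[P]_t (V i t * V j t)%:E <= \int[P]_t (W i t * W j t)%:E) ->
  \int[P]_t ((n%:R^-1 * \sum_i V i t - m) ^+ 2)%:E <=
  \int[P]_t ((n%:R^-1 * \sum_i W i t - m) ^+ 2)%:E.
Proof.
move=> n0 V0 W0 mV mW Vm Wm VW.
rewrite -(@leeD2rE _ (m ^+ 2)%:E)// !square_mean//.
apply: lee_wpmul2l; first by rewrite lee_fin sqr_ge0.
by apply: lee_sum => i _; apply: lee_sum => j _.
Qed.

End mean_squared_error.

(** * Functions of class F1 *)

Section classF1.
Context {R : realType}.

Lemma classF1_monotone (f : R -> R) : classF1 f ->
  exists dir : bool, forall x y, `|x| <= `|y| ->
    if dir then f x <= f y else f y <= f x.
Proof.
move=> [g [[gm|gm] fg]]; [exists true|exists false] => x y xy; rewrite !fg; exact: gm.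
Qed.

(** [f] is the absolute value followed by [g], where truncating the argument at 0 makes [g] monotone
    on the whole line. *)
Lemma measurable_even_monotone (dir : bool) (f : R -> R) :
  (forall x y, `|x| <= `|y| -> if dir then f x <= f y else f y <= f x) ->
  measurable_fun setT f.
Proof.
move=> fm; pose g (x : R) := f (Num.max x 0).
have fE x : f x = (g \o (fun y : R => `|y|)) x.
  rewrite /= /g max_l//; have := fm x `|x|; have := fm `|x| x.
  by case: dir {fm}; rewrite normr_id => /(_ (lexx _)) h1 /(_ (lexx _)) h2;
    apply/eqP; rewrite eq_le h1 h2.
rewrite (funext fE); apply: measurableT_comp; last exact: normr_measurable.
have max0 (u : R) : 0 <= Num.max u 0 by rewrite le_max lexx orbT.
have maxm (x y : R) : x <= y -> `|Num.max x 0| <= `|Num.max y 0|.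
  by move=> xy; rewrite !ger0_norm// ge_max !le_max xy lexx orbT.
rewrite /g; case: dir fm => fm.
  by apply: nondecreasing_measurable => // x y xy; exact: fm (maxm _ _ xy).
by apply: nonincreasing_measurable => // x y xy; exact: fm (maxm _ _ xy).
Qed.

End classF1.

(** Pads a product of two factors by units, so that statements on all samples apply to a pair. *)
Lemma big_pair (S : Type) (idx : S) (op : Monoid.com_law idx) (I : finType)
    (a : I -> S) (i j : I) : i != j ->
  \big[op/idx]_k (if (k == i) || (k == j) then a k else idx) = op (a i) (a j).
Proof.
move=> ij; rewrite (bigD1 i)//= eqxx (bigD1 j)//=; last by rewrite eq_sym.
rewrite eqxx orbT big1 ?Monoid.mulm1// => k /andP[ki kj].
by rewrite (negbTE ki) (negbTE kj).
Qed.

(** * Assembly of the three bounds *)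

Unset Implicit Arguments. Set Strict Implicit.
Theorem theorem1
  (R : realType) (d0 : measure_display) (T : measurableType d0)
  (P : probability T R)
  (dim s nb : nat)
  (* the distribution D, given as the law of a reference random vector w *)
  (w : T -> 'rV[R]_dim)
  (z : 'rV[R]_dim) (f : R -> R)
  (* i.i.d. ensemble *)
  (om_iid : 'I_s -> T -> 'rV[R]_dim)
  (* block-orthogonal ensemble: nb blocks, Haar matrices M b, lengths l i;
     sample i is l i times row (pos i) of M (blk i) *)
  (M : 'I_nb -> T -> 'M[R]_dim) (l : 'I_s -> T -> R)
  (blk : 'I_s -> 'I_nb) (pos : 'I_s -> 'I_dim) :
  (0 < s)%N ->
  (* D isotropic, P(omega = 0) = 0 *)
  rand_mx w ->
  (forall Q : 'M[R]_dim, orthogonal_mx Q ->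
      same_law_mx P (fun t => w t *m Q^T) w) ->
  P [set t | w t = 0] = 0%E ->
  (* f in class F1, X = f(w^T z) integrable *)
  classF1 f ->
  P.-integrable setT (fun t => (f (dotv (w t) z))%:E) ->
  (* i.i.d. samples from D *)
  (forall i, rand_mx (om_iid i) /\ same_law_mx P (om_iid i) w) ->
  mutually_indep P (fun i => events_mx (om_iid i)) ->
  (* block-orthogonal ensemble *)
  injective (fun i => (blk i, pos i)) ->
  (forall b, haar_orthogonal P (M b)) ->
  (forall i, measurable_fun setT (l i) /\ same_law P (l i) (fun t => norm2 (w t))) ->
  mutually_indep P (fun k : 'I_nb + 'I_s =>
     match k with inl b => events_mx (M b) | inr i => events (l i) end) ->
  let X := fun t => f (dotv (w t) z) in
  let F := fine (expect P X) in
  let om_ort := fun i t => l i t *: row (pos i) (M (blk i) t) in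
  let Fiid := fun t => s%:R^-1 * \sum_i f (dotv (om_iid i t) z) in
  let Fort := fun t => s%:R^-1 * \sum_i f (dotv (om_ort i t) z) in
  (* unbiasedness *)
  (P.-integrable setT (fun t => (Fort t)%:E) /\ expect P Fort = F%:E) /\
  (* Cramer-Chernoff bound *)
  (forall eps : R, 0 < eps ->
     (P [set t | (eps <= `|Fort t - F|)%R] <=
      expeR (- (s%:R%:E * legendre P X (F + eps))) +
      expeR (- (s%:R%:E * legendre P X (F - eps))))%E) /\
  (* Hoeffding bound *)
  (forall a b : R, (forall u, a <= f u <= b) ->
   forall eps : R, 0 < eps ->
     (P [set t | (eps <= `|Fort t - F|)%R] <=
      (2 * expR (- (2 * s%:R * eps ^+ 2) / (b - a) ^+ 2))%:E)%E) /\
  (* MSE comparison *)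
  ((\int[P]_t ((X t) ^+ 2)%:E < +oo)%E ->
   (\int[P]_t ((Fort t - F) ^+ 2)%:E <= \int[P]_t ((Fiid t - F) ^+ 2)%:E)%E).
Proof.
move=> s0 mw isow _ fF1 iX lawiid indiid injbp haarM lawl indF X F om_ort Fiid Fort.
have [dir fmono] := classF1_monotone fF1.
have mf : measurable_fun setT f := measurable_even_monotone fmono.
have mX : measurable_fun setT X.
  apply: (measurableT_comp mf); apply: measurable_dotv => //; exact: rand_mx_cst.
have FE : (expect P X = F%:E)%E by rewrite fineK//; exact: integrable_fin_num.
have [sn0 snat] : (s%:R != 0 :> R) /\ 0 < s%:R :> R.
  by rewrite ltr0n pnatr_eq0 -lt0n.
pose V i t := f (dotv (om_ort i t) z).
have mdot i : measurable_fun setT (fun t => dotv (om_ort i t) z).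
  apply: measurable_dotv; last exact: rand_mx_cst.
  apply: rand_mxZ; first exact: (lawl i).1.
  by move=> j k; under eq_fun do rewrite mxE; exact: (haarM _).1.
have mV i : measurable_fun setT (V i) by exact: (measurableT_comp mf).
have lawV i (phi : R -> \bar R) : measurable_fun setT phi ->
    (forall x, 0 <= phi x)%E ->
    (\int[P]_t phi (dotv (om_ort i t) z) = \int[P]_t phi (dotv (w t) z))%E.
  exact: (integral_ort_sample z blk pos mw isow haarM lawl indF).
have iV i : P.-integrable setT (EFin \o V i).
  apply/integrableP; split; first exact/measurable_EFinP.
  rewrite (lawV i (fun x => `|(f x)%:E|)%E)//.
    by have /integrableP[] := iX.
  by apply: measurableT_comp => //; exact/measurable_EFinP.
(* [lawV] handles nonnegative functions only, so the positive and negative parts of [f] are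
   transferred separately. *)
have EV i : (\int[P]_t (V i t)%:E = F%:E)%E.
  have mfE : measurable_fun setT (EFin \o f) by exact/measurable_EFinP.
  pose g t := dotv (om_ort i t) z; pose g' t := dotv (w t) z.
  rewrite -FE -[LHS]/(\int[P]_t ((EFin \o f) \o g) t)%E.
  rewrite -[RHS]/(\int[P]_t ((EFin \o f) \o g') t)%E.
  rewrite integralE [RHS]integralE.
  rewrite !(funepos_comp (EFin \o f) g, funepos_comp (EFin \o f) g').
  rewrite !(funeneg_comp (EFin \o f) g, funeneg_comp (EFin \o f) g').
  congr (_ - _)%E.
    exact: (lawV i _ (measurable_funepos mfE) (funepos_ge0 _)).
  exact: (lawV i _ (measurable_funeneg mfE) (funeneg_ge0 _)).
have mFort : measurable_fun setT Fort.
  by apply: measurable_funM => //; exact: measurable_sum.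
have iS : P.-integrable setT (fun t => \sum_i (V i t)%:E)%E.
  by apply: integrable_sum => // i _; exact: iV.
have FortE : (fun t => (Fort t)%:E) = (fun t => (s%:R^-1)%:E * \sum_i (V i t)%:E)%E.
  by apply/funext => t; rewrite sumEFin -EFinM.
have sumexp theta :
    (mgf P (fun t => (\sum_i V i t)%R) theta <= mgf P X theta ^+ s)%E.
  rewrite /mgf.
  under eq_integral do rewrite mulr_sumr expR_sum.
  have -> : (mgf P X theta ^+ s = \prod_(i < s) mgf P X theta)%E.
    by elim: (s) => [|k IH]; rewrite ?big_ord0// big_ord_recl -IH expeS.
  (* The function exp(theta f) follows the direction of [f] for nonnegative [theta] and the opposite
     one otherwise. *)
  apply: (ort_samples_neg_dep z mw isow injbp haarM lawl indF
    (dir := if 0 <= theta then dir else ~~ dir) (h := fun _ x => expR (theta * f x))).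
  - by move=> _ x; exact: expR_ge0.
  - move=> _; apply: (measurableT_comp (@measurable_expR R)).
    exact: measurable_funM.
  - move=> _ x y /fmono; case: (leP 0 theta) => [t0|/ltW t0]; case: (dir) => /= fxy; rewrite ler_expR.
    + exact: ler_wpM2l.
    + exact: ler_wpM2l.
    + exact: ler_wnM2l.
    + exact: ler_wnM2l.
have tail theta a (E : set T) : measurable E ->
    (forall t, E t -> theta * a <= theta * Fort t) ->
    (P E <= (expR (- (theta * (s%:R * a))))%:E * mgf P X theta ^+ s)%E.
  move=> mE Ea; apply: (@le_trans _ _ ((expR (- (theta * (s%:R * a))))%:E *
      mgf P (fun t => (\sum_i V i t)%R) theta)%E); last first.
    by apply: lee_wpmul2l => //; rewrite lee_fin expR_ge0.
  apply: chernoff_le => //; first exact: measurable_sum.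
  move=> t /Ea; rewrite /Fort -(ler_pM2l snat) => h.
  rewrite mulrCA; apply: (le_trans h).
  by rewrite le_eqVlt mulrCA mulVKf// eqxx.
pose Eu eps := [set t | F + eps <= Fort t]; pose El eps := [set t | Fort t <= F - eps].
have mEu eps : measurable (Eu eps).
  have := measurable_fun_ler (measurable_cst (F + eps)) mFort.
  by move=> /(_ measurableT [set true] I); rewrite setTI.
have mEl eps : measurable (El eps).
  have := measurable_fun_ler mFort (measurable_cst (F - eps)).
  by move=> /(_ measurableT [set true] I); rewrite setTI.
have split_tail eps : (P [set t | (eps <= `|Fort t - F|)%R] <= P (Eu eps) + P (El eps))%E.
  apply: le_trans (measureU2 P (mEu eps) (mEl eps)).
  rewrite (_ : [set t | _] = Eu eps `|` El eps)//.
  apply/seteqP; split=> t; rewrite /Eu /El /= ler_normr.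
    by move=> /orP[h|h]; [left|right]; lra.
  by move=> [h|h]; apply/orP; [left|right]; lra.
split; [|split; [|split]].
- rewrite FortE; split; first exact: integrableZl.
  rewrite /expect FortE integralZl// integral_sum//.
  under eq_bigr do rewrite EV.
  by rewrite sumEFin sumr_const card_ord -EFinM -[(F *+ s)%R]mulr_natl mulKf.
- move=> eps eps0; apply: (le_trans (split_tail eps)); apply: leeD.
  + have -> : legendre P X (F + eps) =
      ereal_sup [set legendre_term P X (F + eps) th | th in [set th : R | 0 < th]].
      by rewrite /legendre -/F ltrDl eps0.
    rewrite -[P (Eu eps)]fineK ?fin_num_measure//.
    apply: le_expeR_sup => //; first exact: fine_ge0.
    move=> x [th th0 <-]; rewrite fineK ?fin_num_measure//.
    apply: chernoff_legendre_term => //; first exact: probability_le1.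
    by apply: tail => // t; rewrite ler_pM2l.
  + have -> : legendre P X (F - eps) =
      ereal_sup [set legendre_term P X (F - eps) th | th in [set th : R | th < 0]].
      by rewrite /legendre -/F ltrDl oppr_gt0 ltNge (ltW eps0).
    rewrite -[P (El eps)]fineK ?fin_num_measure//.
    apply: le_expeR_sup => //; first exact: fine_ge0.
    move=> x [th th0 <-]; rewrite fineK ?fin_num_measure//.
    apply: chernoff_legendre_term => //; first exact: probability_le1.
    by apply: tail => // t; rewrite ler_nM2l.
- move=> a b fab eps eps0.
  have ab : a <= b by have /andP[h1 h2] := fab 0; exact: le_trans h1 h2.
  (* For [a = b] the quotient by 0 is 0, so the bound to prove is 2. *)
  have [ab0|abn] := eqVneq a b.
    rewrite ab0 subrr expr0n/= invr0 mulr0 expR0 mulr1.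
    apply: (le_trans (split_tail eps)); rewrite (_ : 2%:E = 1 + 1)%E//.
    by apply: leeD; exact: probability_le1.
  have ltab : a < b by rewrite lt_neqAle abn.
  have ba : b - a != 0 by rewrite subr_eq0 eq_sym.
  pose Hb := expR (- (2 * s%:R * eps ^+ 2) / (b - a) ^+ 2).
  (* The sign [sg] selects the tail. The magnitude 4 eps / (b - a)^2 of [th] is the minimizer of - x
     eps + x^2 (b - a)^2 / 8. *)
  have hoef sg (E : set T) : sg ^+ 2 = 1 -> measurable E ->
      (forall t, E t -> sg * (F + sg * eps) <= sg * Fort t) -> (P E <= Hb%:E)%E.
    move=> sg2 mE Et; pose th := sg * (4 * eps / (b - a) ^+ 2).
    have c0 : 0 <= 4 * eps / (b - a) ^+ 2.
      by rewrite divr_ge0 ?sqr_ge0// mulr_ge0// ltW.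
    have := @tail th (F + sg * eps) E mE; move=> /(_ _)/le_trans; apply.
      move=> t /Et h; rewrite /th; move: c0; set c := 4 * eps / _ => c0.
      by rewrite ![sg * c]mulrC -!(mulrA c); exact: ler_wpM2l.
    have mb := hoeffding_lemma th iX ltab (fun t => fab _).
    apply: (@le_trans _ _ ((expR (- (th * (s%:R * (F + sg * eps)))))%:E *
      ((expR (th * F + th ^+ 2 * (b - a) ^+ 2 / 8))%:E ^+ s))%E).
      apply: lee_wpmul2l; first by rewrite lee_fin expR_ge0.
      elim: (s) => [|k IH]; first by rewrite !expe0.
      by rewrite !expeS lee_pmul ?expe_ge0 ?mgf_ge0.
    rewrite -EFin_expe -EFinM lee_fin -expRM_natl -expRD ler_expR le_eqVlt.
    apply/orP; left; apply/eqP.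
    rewrite (_ : th ^+ 2 = (4 * eps / (b - a) ^+ 2) ^+ 2); last first.
      by rewrite /th exprMn sg2 mul1r.
    rewrite (_ : th * (s%:R * (F + sg * eps)) =
      s%:R * (th * F) + s%:R * (4 * eps / (b - a) ^+ 2) * eps); last first.
      by rewrite /th; ring: sg2.
    by field.
  apply: (le_trans (split_tail eps)).
  rewrite (_ : (2 * Hb)%:E = Hb%:E + Hb%:E)%E; last by rewrite -EFinD; congr EFin; ring.
  apply: leeD.
    apply: (hoef 1) => //; first by rewrite expr1n.
    by move=> t; rewrite !mul1r.
  apply: (hoef (-1)) => //; first by rewrite sqrrN expr1n.
  by move=> t; rewrite !mulN1r lerN2.
- move=> _.
  (* Shifting by [f 0] and fixing the sign makes [y] nonnegative and nondecreasing in the absolute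
     value, with mean [m], while leaving the squared errors unchanged. *)
  pose y x := if dir then f x - f 0 else f 0 - f x.
  pose m := if dir then F - f 0 else f 0 - F.
  have y0 x : 0 <= y x.
    have := fmono 0 x; rewrite normr0 normr_ge0 /y.
    by case: (dir) => /(_ isT) h; rewrite subr_ge0.
  have my : measurable_fun setT y.
    by rewrite /y; case: (dir); exact: measurable_funB.
  have ym u v : `|u| <= `|v| -> y u <= y v.
    by move=> /fmono; rewrite /y; case: (dir) => h; rewrite lerB.
  have myE : measurable_fun setT (EFin \o y) by exact/measurable_EFinP.
  have Ey : (\int[P]_t (y (dotv (w t) z))%:E = m%:E)%E.
    have if0 : P.-integrable setT (cst (f 0)%:E) by exact: finite_measure_integrable_cst.
    have cst0 : (\int[P]_t (cst (f 0)%:E t) = (f 0)%:E)%E.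
      by rewrite integral_cst// [X in (_ * X)%E]probability_setT mule1.
    rewrite /y /m; case: (dir).
      under eq_integral do rewrite EFinB.
      by rewrite integralB// cst0 [X in (X - _)%E]FE EFinB.
    under eq_integral do rewrite EFinB.
    by rewrite integralB// cst0 [X in (_ - X)%E]FE EFinB.
  have meanE (u : 'I_s -> R) : (s%:R^-1 * (\sum_i f (u i)) - F) ^+ 2 =
      (s%:R^-1 * (\sum_i y (u i)) - m) ^+ 2.
    rewrite /y /m; case: (dir); rewrite sumrB sumr_const card_ord -mulr_natl;
    by field.
  have lawW i (phi : R -> \bar R) : measurable_fun setT phi ->
      (forall x, 0 <= phi x)%E ->
      (\int[P]_t phi (dotv (om_iid i t) z) = \int[P]_t phi (dotv (w t) z))%E.
    move=> mphi phi0; have [mi li] := lawiid i.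
    apply: (integral_same_law_mx (phi := fun A : mxT 1 dim => phi (dotv A z))) => //.
    apply: (measurableT_comp mphi); apply: measurable_dotv; last exact: rand_mx_cst.
    by move=> ? ?; exact: measurable_coord.
  have mdoti i : measurable_fun setT (fun t => dotv (om_iid i t) z).
    by apply: measurable_dotv; [exact: (lawiid i).1|exact: rand_mx_cst].
  under eq_integral do rewrite meanE.
  under [leRHS]eq_integral do rewrite meanE.
  apply: (le_mse_mean (V := fun i t => y (dotv (om_ort i t) z))
    (W := fun i t => y (dotv (om_iid i t) z))) => //.
  + by move=> i; exact: (measurableT_comp my).
  + by move=> i; exact: (measurableT_comp my).
  + by move=> i; rewrite (lawV i (EFin \o y))// => x; rewrite lee_fin.
  + by move=> i; rewrite (lawW i (EFin \o y))// => x; rewrite lee_fin.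
  (* Diagonal terms agree because the marginals do. Off the diagonal [m * m] separates the two
     sides: negative dependence bounds the orthogonal pair by it, and independence makes the i.i.d.
     pair equal to it. *)
  move=> i j; have [<-|ij] := eqVneq i j.
    have my2 : measurable_fun setT (fun x => (y x * y x)%:E).
      by apply/measurable_EFinP; exact: measurable_funM.
    have y20 x : (0 <= (y x * y x)%:E)%E by rewrite lee_fin mulr_ge0.
    by rewrite (lawV i _ my2 y20) (lawW i _ my2 y20).
  pose sel k := (k == i) || (k == j).
  have P1 : (\int[P]_t (1%:E) = 1 :> \bar R)%E.
    by rewrite integral_cst// mul1e; exact: probability_setT.
  apply: (@le_trans _ _ (m%:E * m%:E)%E).
    rewrite -(@big_pair _ _ mule _ (fun=> m%:E) _ _ ij).
    under eq_integral => t _.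
      rewrite -(@big_pair _ _ *%R _ (fun k => y (dotv (om_ort k t) z)) _ _ ij).
      rewrite (eq_bigr (fun k => (if sel k then y else cst 1) (dotv (om_ort k t) z)));
        last by move=> k _; rewrite /sel; case: ifP.
      over.
    rewrite [leRHS](eq_bigr (fun k =>
      \int[P]_t ((if sel k then y else cst 1) (dotv (w t) z))%:E)%E); last first.
      by move=> k _; rewrite /sel; case: ifP; rewrite ?Ey ?P1.
    apply: (ort_samples_neg_dep z mw isow injbp haarM lawl indF (dir := true)
      (h := fun k => if sel k then y else cst 1)) => k; case: (sel k) => //.
  rewrite -(@big_pair _ _ mule _ (fun=> m%:E) _ _ ij).
  under [leRHS]eq_integral => t _.
    rewrite EFinM -(@big_pair _ _ mule _ (fun k => (y (dotv (om_iid k t) z))%:E) _ _ ij).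
    rewrite (eq_bigr (fun k => ((if sel k then y else cst 1) (dotv (om_iid k t) z))%:E));
      last by move=> k _; rewrite /sel; case: ifP.
    over.
  have mom k : rand_mx (om_iid k) := (lawiid k).1.
  rewrite (integral_prod_indep (fun k => @events_mx_measurable _ _ _ _ _ _ (mom k))
    (fun k => @events_mx_setI _ _ _ _ _ (om_iid k))
    (fun k => @events_mx_setT _ _ _ _ _ (om_iid k)) indiid).
  + rewrite le_eqVlt; apply/orP; left; apply/eqP; apply: eq_bigr => k _.
    rewrite /sel; case: ifP => _; last by rewrite P1.
    by rewrite (lawW k (EFin \o y))// => x; rewrite lee_fin.
  + by move=> k t; rewrite lee_fin; case: ifP.
  + move=> k B mB.
    apply: (@events_mx_comp _ _ _ _ _ (om_iid k) _ _ (fun A : mxT 1 dim =>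
      ((if sel k then y else cst 1) (dotv A z))%:E) B) => //.
    apply/measurable_EFinP; apply: measurableT_comp; first by case: (sel k).
    apply: measurable_dotv; last exact: rand_mx_cst.
    by move=> ? ?; exact: measurable_coord.
Qed.
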